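(* For every $\epsilon \in (0,\tfrac23)$ there exists a constant $c>0$ (depending only on $\epsilon$) such that the following holds. Let $n,k,m$ be positive integers with $k\ge 2$ and let $R \ge 1$ be a real number such that $k \le n^{\frac23-\epsilon}$, $R \le \min\big(n^{0.5\epsilon},\, k^{0.5-\epsilon}\big)$, and $$ m < c\,R\left(\frac{k}{\log k}\right)^{3/2}\min\left(R^2, \log^2 k\right). $$ Let $A=(a_{i,j}) \in \mathbb{R}^{m\times n}$ have i.i.d. standard Gaussian entries. Then, with probability at least $1/3$, $A$ is not a valid universal $1$-bit measurement matrix for support recovery on $\mathcal{X}_k(R)$.
   Context: $\log$ is the natural logarithm. The function $\mathrm{sign}(\cdot)$ is applied entrywise, with values in $\{-1,1\}$ and the convention $\mathrm{sign}(0)=1$. For $x\in\mathbb{R}^n$, $\mathrm{supp}(x)$ is the set of indices of nonzero entries and $\|x\|_0=|\mathrm{supp}(x)|$. For $R\ge 1$, $\mathcal{X}_k(R)$ is the set of (nonzero) $x \in \mathbb{R}^n$ with $\|x\|_0\le k$ and $\frac{\max_{i\in \mathrm{supp}(x)}|x_i|}{\min_{i\in \mathrm{supp}(x)}|x_i|}\le R$. A matrix $A\in\mathbb{R}^{m\times n}$ is a valid universal $1$-bit measurement matrix for support recovery on $\mathcal{X}_k(R)$ if and only if for all $u,v\in\mathcal{X}_k(R)$, $\mathrm{supp}(u)\ne \mathrm{supp}(v)$ implies $\mathrm{sign}(Au)\neq \mathrm{sign}(Av)$. *)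

(* Defs.v *)
From HB Require Import structures.
From mathcomp Require Export all_boot all_order all_algebra.
From mathcomp Require Export all_classical all_reals all_analysis.

Set Implicit Arguments.
Unset Strict Implicit.
Unset Printing Implicit Defensive.

Import Order.TTheory GRing.Theory Num.Theory.
Import numFieldNormedType.Exports.

Local Open Scope classical_set_scope.
Local Open Scope ring_scope.

(* Unlike [Num.sg], this takes the value 1 at 0. *)
Definition sign1 {R : realType} (x : R) : R := if 0 <= x then 1 else -1.

Definition sign_vec {R : realType} {m : nat} (y : 'cV[R]_m) : 'cV[R]_m :=
  map_mx sign1 y.

Definition supp {R : realType} {n : nat} (x : 'cV[R]_n) : {set 'I_n} :=
  [set i | x i ord0 != 0]%SET.

Definition norm0 {R : realType} {n : nat} (x : 'cV[R]_n) : nat := #|supp x|.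

Definition max_abs {R : realType} {n : nat} (x : 'cV[R]_n) : R :=
  \big[Num.max/0]_(i in supp x) `|x i ord0|.

(* [Num.min] has no neutral element in [R]; seeding with [max_abs x] gives the
   minimum over the support whenever [x != 0]. *)
Definition min_abs {R : realType} {n : nat} (x : 'cV[R]_n) : R :=
  \big[Num.min/max_abs x]_(i in supp x) `|x i ord0|.

Definition sparse_vecs {R : realType} {n : nat} (k : nat) (r : R) : set 'cV[R]_n :=
  [set x | [/\ x != 0, (norm0 x <= k)%N & max_abs x / min_abs x <= r]].

Definition universal_support_recovery {R : realType} {m n : nat}
    (k : nat) (r : R) (A : 'M[R]_(m, n)) : Prop :=
  forall u v : 'cV[R]_n, sparse_vecs k r u -> sparse_vecs k r v ->
    supp u <> supp v -> sign_vec (A *m u) <> sign_vec (A *m v).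

Definition mutually_independent {R : realType} {d : measure_display}
    {T : measurableType d} (P : probability T R) {I : finType}
    (X : I -> {RV P >-> R}) : Prop :=
  forall (J : {set I}) (B : I -> set R), (forall i, measurable (B i)) ->
    P (\bigcap_(i in [set` J]) X i @^-1` B i) =
    (\prod_(i in J) P (X i @^-1` B i))%E.

(* Laws are compared on Borel sets only: the functions [distribution P X] and
   [normal_prob 0 1] are also defined, as junk, on the other sets. *)
Definition standard_gaussian {R : realType} {d : measure_display}
    {T : measurableType d} (P : probability T R) (X : {RV P >-> R}) : Prop :=
  forall B : set R, measurable B -> distribution P X B = normal_prob 0 1 B.

Definition iid_standard_gaussian {R : realType} {d : measure_display}
    {T : measurableType d} (P : probability T R) {m n : nat}
    (a : 'I_m * 'I_n -> {RV P >-> R}) : Prop :=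
  mutually_independent a /\ forall ij, standard_gaussian (a ij).

Definition random_matrix {R : realType} {d : measure_display}
    {T : measurableType d} (P : probability T R) {m n : nat}
    (a : 'I_m * 'I_n -> {RV P >-> R}) (w : T) : 'M[R]_(m, n) :=
  \matrix_(i < m, j < n) a (i, j) w.

(* Main.v *)
(* Second moment method. Put [K = k - 1] and let [sigma] choose one column from
   each of [K] disjoint blocks of [B ~ n / k] columns, keeping one spare column
   [j0]. If [u] equals [r] on the chosen columns and [0] elsewhere, then [u] and
   [v = u + e_{j0}] have the same signs as soon as, in every row, the sum of the
   chosen entries exceeds [t] in absolute value and the entry in column [j0] is
   at most [r t]; with [t = 4 sqrt (ln k) / r] the latter holds by a union bound.
   A row is bad for [sigma] with probability about [t / sqrt K], and two choices
   agreeing on [N] blocks have row sums of correlation [N / K]. Since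
   [k <= n ^ (2 / 3 - eps)] gives [B >= k ^ (1 / 2 + 2 eps) / 2], typical overlaps
   are too small to be felt, and overlaps [N > K / 2] are so rare (about
   [B ^ (- K / 2)]) that they beat the crude bound [exp (4 m t / sqrt K)] on
   their contribution. *)
From HB Require Import structures.
Require Import Defs.
From mathcomp Require Import all_boot all_order all_algebra.
From mathcomp Require Import all_classical all_reals all_analysis.
From mathcomp Require Import measurable_realfun zify ring lra.
Import Order.TTheory GRing.Theory Num.Theory.
Import numFieldNormedType.Exports.
Local Open Scope classical_set_scope.
Local Open Scope ring_scope.
Set Implicit Arguments.
Unset Strict Implicit.
Unset Printing Implicit Defensive.

(** * Independence of sigma-algebras generated by disjoint blocks of variables *)

Section independence.
Context {R : realType} {d : measure_display} {T : measurableType d}.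
Variables (P : probability T R) (I : finType) (X : I -> {RV P >-> R}).

(** Non-recovery quantifies over uncountably many pairs of vectors, so its measurability is a
    theorem of its own: once the supports and the common sign pattern are fixed and the vectors
    rescaled, it becomes the existence of zeros of continuous functions confined to a compact box,
    which rational points decide. No bivariate Gaussian law is needed. The event that two row sums
    are both small is bounded by conditioning on the shared part and spreading the remaining entries
    with the peak of their own density. What matters is the excess over the product of the two
    probabilities, hence bounds for a single row from both sides. The exponent [2 / 3 - eps] enters
    through [(3 / 2 + 2 eps) (2 / 3 - eps) <= 1]: it gives [k ^ (3 / 2 + 2 eps) <= n], and the
    surplus [k ^ (2 eps)] in the block size absorbs every power of [ln k]. Since [m >= 1], a small
    [c] already forces [k] to be huge, so no small case remains. The second moment yields [1 / 2],
    the union bound costs at most [1 / 6], and [1 / 3] is left. *)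

Definition cylinder (J : {set I}) : set (set T) :=
  [set C | exists2 B : I -> set R, (forall i, measurable (B i)) &
    C = \bigcap_(i in [set` J]) X i @^-1` B i].

(** This is the sigma-algebra generated by the variables indexed by [J]. Presenting it through the
    pi-system of rectangles lets product formulas extend by uniqueness of measures. *)
Definition sigma_of (J : {set I}) : set (set T) := <<s cylinder J >>.

Lemma measurable_cylinder (J : {set I}) C : cylinder J C -> measurable C.
Proof.
case=> B mB ->; apply: fin_bigcap_measurable => [|i _]; first exact: finite_finset.
by rewrite -[_ @^-1` _]setTI; exact: measurable_funP.
Qed.

Lemma measurable_sigma_of (J : {set I}) C : sigma_of J C -> measurable C.
Proof.
apply: smallest_sub; first exact: sigma_algebra_measurable.
exact: measurable_cylinder.
Qed.

Lemma cylinderI (J : {set I}) : setI_closed (cylinder J).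
Proof.
move=> _ _ [B mB ->] [B' mB' ->]; exists (fun i => B i `&` B' i).
  by move=> i; exact: measurableI.
apply/seteqP; split=> w /=.
  by case=> h h' i Ji; split; [exact: h|exact: h'].
by move=> h; split=> i Ji; have [] := h i Ji.
Qed.

Lemma cylinderT (J : {set I}) : cylinder J setT.
Proof. by exists (fun=> setT) => //; apply/seteqP; split. Qed.

Lemma sub_cylinder (J J' : {set I}) : J \subset J' -> cylinder J `<=` cylinder J'.
Proof.
move=> /fintype.subsetP JJ' _ [B mB ->].
exists (fun i => if i \in J then B i else setT) => [i|]; first by case: ifP.
apply/seteqP; split=> w /= h i Ji.
  by case: ifP => [iJ|//]; exact: h.
by have := h i (JJ' _ Ji); rewrite Ji.
Qed.

Lemma sub_sigma_of (J J' : {set I}) : J \subset J' -> sigma_of J `<=` sigma_of J'.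
Proof.
move=> JJ'; apply: smallest_sub; first exact: smallest_sigma_algebra.
by move=> C /(sub_cylinder JJ'); exact: sub_sigma_algebra.
Qed.

Lemma measurable_sigma_of_RV (J : {set I}) i : i \in J ->
  measurable_fun (setT : set (g_sigma_algebraType (cylinder J))) (X i).
Proof.
move=> iJ _ B mB; rewrite setTI; apply: sub_sigma_algebra.
exists (fun j => if j == i then B else setT) => [j|]; first by case: ifP.
apply/seteqP; split=> w /= h; last by have := h i iJ; rewrite eqxx.
by move=> j _; case: eqP => [->|].
Qed.

Hypothesis indepX : mutually_independent X.

Lemma cylinder_independent (J J' : {set I}) A C : [disjoint J & J']%B ->
  cylinder J A -> cylinder J' C -> P (A `&` C) = (P A * P C)%E.
Proof.
move=> JJ' [B mB ->] [B' mB' ->].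
pose D i := if i \in J then B i else B' i.
have mD i : measurable (D i) by rewrite /D; case: ifP.
have DJ i : i \in J -> D i = B i by rewrite /D => ->.
have DJ' i : i \in J' -> D i = B' i.
  by rewrite /D => iJ'; rewrite (disjointFl JJ' iJ').
have -> : \bigcap_(i in [set` J]) X i @^-1` B i `&`
    \bigcap_(i in [set` J']) X i @^-1` B' i =
    \bigcap_(i in [set` (J :|: J')%SET]) X i @^-1` D i.
  apply/seteqP; split=> w /=.
    move=> [h h'] i /=; rewrite finset.in_setU => /orP[] ij /=.
      by rewrite DJ //; exact: h.
    by rewrite DJ' //; exact: h'.
  move=> h; split=> i /= ij.
    by rewrite -DJ //; apply: h; rewrite /= finset.in_setU ij.
  by rewrite -DJ' //; apply: h; rewrite /= finset.in_setU ij orbT.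
rewrite !indepX // (eq_bigl [predU J & J']) => [|i]; last first.
  by rewrite finset.in_setU.
rewrite bigU //=; congr (_ * _)%E; apply: eq_bigr => i iJ.
  by rewrite DJ.
by rewrite DJ'.
Qed.

(** Dynkin's argument, one side at a time: for fixed [F] the finite measures [P (E & F)] and
    [P F * P E] of [E] agree on a pi-system, hence on what it generates. [half] is used twice, to
    pass from rectangles to [sigma_of J'] and then to [sigma_of J]. *)
Lemma sigma_of_independent (J J' : {set I}) A C : [disjoint J & J']%B ->
  sigma_of J A -> sigma_of J' C -> P (A `&` C) = (P A * P C)%E.
Proof.
move=> JJ' sA sC.
have half (K K' : {set I}) (G : set (set T)) D : G `<=` measurable ->
    (forall E F, cylinder K E -> G F -> P (E `&` F) = (P E * P F)%E) ->
    sigma_of K D -> forall F, G F -> P (D `&` F) = (P D * P F)%E.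
  move=> Gm h sD F GF; have mF := Gm _ GF.
  have PF0 : 0 <= fine (P F) by apply: fine_ge0.
  rewrite muleC.
  pose m1 := mrestr P mF; pose m2 := mscale (NngNum PF0) P.
  suff: m1 D = m2 D.
    move=> m12; have : m1 D = ((fine (P F))%:E * P D)%E by rewrite m12.
    by rewrite /m1 /mrestr fineK// fin_num_measure.
  apply: (g_sigma_algebra_measure_unique (cylinder K) _ (fun=> setT)) => //.
  - exact: measurable_cylinder.
  - by move=> _; exact: cylinderT.
  - by rewrite bigcup_const.
  - exact: cylinderI.
  - move=> E cE; rewrite [RHS](_ : _ = ((fine (P F))%:E * P E)%E)//.
    by rewrite fineK ?fin_num_measure// muleC; exact: h.
  - move=> _; rewrite /mrestr/= (le_lt_trans (probability_le1 _ _)) ?ltry//.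
    exact: measurableI.
apply: (half J J' (sigma_of J')) => //.
  by move=> F; exact: measurable_sigma_of.
move=> E F cE sF; rewrite setIC muleC.
apply: (half J' J (cylinder J)) => //.
  by move=> ?; exact: measurable_cylinder.
move=> E' F' cE' cF'; apply: cylinder_independent cE' cF' => //.
by rewrite disjoint_sym.
Qed.

Lemma sigma_of_independent_seq (U : eqType) (s : seq U) (J : U -> {set I})
    (E : U -> set T) : uniq s ->
  (forall u v, u != v -> [disjoint J u & J v]%B) ->
  (forall u, sigma_of (J u) (E u)) ->
  P (\bigcap_(u in [set` s]) E u) = (\prod_(u <- s) P (E u))%E.
Proof.
move=> us dJ sE.
(* The induction also carries that the intersection depends only on the union of the blocks; without
   it the product formula for two sets could not be applied to the tail. *)
suff [] : sigma_of (\bigcup_(u <- s) J u)%SET (\bigcap_(u in [set` s]) E u) /\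
    P (\bigcap_(u in [set` s]) E u) = (\prod_(u <- s) P (E u))%E by [].
elim: s us => [_|u s IH /= /andP[us /IH[sI PI]]].
  rewrite big_nil set_nil bigcap_set0 big_nil probability_setT; split => //.
  exact: sub_sigma_algebra (cylinderT _).
have -> : \bigcap_(v in [set` u :: s]) E v =
    E u `&` \bigcap_(v in [set` s]) E v.
  apply/seteqP; split=> w /=.
    move=> h; split=> [|v vs]; apply: h; rewrite /= inE ?eqxx//.
    by rewrite vs orbT.
  by case=> hu h v; rewrite /= inE => /orP[/eqP->//|/h].
rewrite !big_cons; split.
  apply: (@measurableI _ (g_sigma_algebraType (cylinder _))).
    by apply: sub_sigma_of (sE u); exact: finset.subsetUl.
  by apply: sub_sigma_of sI; exact: finset.subsetUr.
rewrite (@sigma_of_independent (J u) (\bigcup_(v <- s) J v)%SET) ?PI//.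
rewrite disjoint_sym; elim: (s) us => [|v s' IHs].
  by rewrite big_nil -setI_eq0 finset.set0I.
rewrite inE negb_or => /andP[uv us']; rewrite big_cons -setI_eq0 finset.setIUl.
by rewrite finset.setU_eq0 !setI_eq0 IHs// andbT dJ// eq_sym.
Qed.

End independence.

(** * Gaussian densities: translation, convolution, interval and tail bounds *)

Section normal_sums.
Context {R : realType}.
Local Notation mu := (@lebesgue_measure R).

Lemma lebesgue_measure_translation (y : R) (A : set R) : measurable A ->
  mu ((fun x => y + x) @^-1` A) = mu A.
Proof.
move=> mA.
have mt : measurable_fun setT ((fun x => y + x) : measurableTypeR R -> measurableTypeR R).
  exact: measurable_funD.
rewrite -[LHS]/(pushforward mu ((fun x => y + x) : measurableTypeR R -> measurableTypeR R) A).
apply/esym.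
apply: (@lebesgue_measure_unique _ (pushforward mu _)) => //= _ [[a b]] _ <-.
rewrite /pushforward /=.
have -> : (fun x => y + x) @^-1` `]a, b]%classic = `]a - y, b - y]%classic.
  by apply/seteqP; split=> x /=; rewrite !in_itv/= => /andP[? ?]; apply/andP; lra.
rewrite !lebesgue_measure_itv/= !lte_fin ltrD2r; case: ifP => // _.
by rewrite -!EFinB; congr EFin; lra.
Qed.

Lemma normal_prob_translation (s y : R) (B : set R) : s != 0 -> measurable B ->
  normal_prob 0 s ((fun x => y + x) @^-1` B) = normal_prob y s B.
Proof.
move=> s0 mB; pose t : measurableTypeR R -> measurableTypeR R := fun x => y + x.
have mt : measurable_fun setT t by exact: measurable_funD.
transitivity (\int[pushforward mu t]_(x in B) (normal_pdf y s x)%:E)%E.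
  rewrite (ge0_integral_pushforward mt mu mB).
  - apply: eq_integral => x _ /=; rewrite !normal_pdfE// /normal_fun /t.
    by rewrite subr0 addrAC subrr add0r.
  - apply/measurable_EFinP/measurable_funTS; exact: measurable_normal_pdf.
  - by move=> x _; rewrite lee_fin normal_pdf_ge0.
by apply: eq_measure_integral => A mA _; exact: lebesgue_measure_translation.
Qed.

(** Change of variables produces a Radon-Nikodym derivative; it equals the explicit density almost
    everywhere because both have the same integral on every measurable set. *)
Lemma ge0_integral_normal_prob (m s : R) (f : R -> \bar R) :
  measurable_fun setT f -> (forall x, 0 <= f x)%E ->
  (\int[normal_prob m s]_x f x = \int[mu]_x (f x * (normal_pdf m s x)%:E))%E.
Proof.
move=> mf f0; have dom := normal_prob_dominates m s.
rewrite -(Radon_Nikodym_SigmaFinite.change_of_variables dom)//.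
have mrn : measurable_fun setT (Radon_Nikodym_SigmaFinite.f (normal_prob m s) mu).
  exact: measurable_int (Radon_Nikodym_SigmaFinite.f_integrable dom).
have mpdf : measurable_fun setT (EFin \o normal_pdf m s).
  by apply/measurable_EFinP; exact: measurable_normal_pdf.
apply: ae_eq_integral => //; try exact: emeasurable_funM.
suff : ae_eq mu setT (Radon_Nikodym_SigmaFinite.f (normal_prob m s) mu)
    (EFin \o normal_pdf m s) by apply: filterS => x /= h Tx; rewrite h.
apply: integral_ae_eq => //.
  exact: Radon_Nikodym_SigmaFinite.f_integrable.
by move=> A _ mA; rewrite -Radon_Nikodym_SigmaFinite.f_integral.
Qed.

(** Completing the square in [y]: the joint density is the marginal of [z] times the conditional
    density of [y] given [z]. Integrating [y] out then gives the convolution formula. *)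
Lemma normal_pdf_mul (s t y z : R) : 0 < s -> 0 < t ->
  let r := Num.sqrt (s ^+ 2 + t ^+ 2) in
  normal_pdf 0 s y * normal_pdf y t z =
  normal_pdf 0 r z * normal_pdf (z * s ^+ 2 / r ^+ 2) (s * t / r) y.
Proof.
move=> s0 t0 r.
have st0 : 0 < s ^+ 2 + t ^+ 2 by rewrite addr_gt0 ?exprn_gt0.
have r0 : 0 < r by rewrite sqrtr_gt0.
have r2 : r ^+ 2 = s ^+ 2 + t ^+ 2 by rewrite sqr_sqrtr// ltW.
have n0 (x : R) : 0 < x -> x != 0 by move=> /gt_eqF ->.
have str0 : 0 < s * t / r by rewrite divr_gt0 ?mulr_gt0.
have peak (a b p : R) : a + b != 0 -> a * p *+ 2 * (b * p *+ 2) =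
    (a + b) * p *+ 2 * (a * b / (a + b) * p *+ 2) by move=> ?; field.
rewrite !normal_pdfE ?n0// /normal_fun mulrACA [RHS]mulrACA -!expRD.
have -> : (s * t / r) ^+ 2 = s ^+ 2 * t ^+ 2 / r ^+ 2.
  by rewrite !exprMn exprVn.
have -> : normal_peak s * normal_peak t = normal_peak r * normal_peak (s * t / r).
  rewrite /normal_peak -!invfM -!sqrtrM ?mulrn_wge0 ?mulr_ge0 ?pi_ge0 ?sqr_ge0 ?(ltW s0) ?(ltW r0)//.
  apply: (congr1 (fun x => (Num.sqrt x)^-1)).
  by rewrite !exprMn exprVn r2; apply: peak; rewrite n0.
rewrite r2; apply: f_equal; apply: f_equal.

by field; rewrite !n0.
Qed.

Lemma normal_prob_indicE (y t : R) (B : set R) :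
  normal_prob y t B = (\int[mu]_z ((normal_pdf y t z) * \1_B z)%:E)%E.
Proof.
rewrite /normal_prob integral_mkcond; apply: eq_integral => z _.
by rewrite epatch_indic EFinM.
Qed.

Lemma measurable_normal_pdf_pair (t : R) : t != 0 ->
  measurable_fun setT (fun yz : R * R => normal_pdf yz.1 t yz.2).
Proof.
move=> t0; rewrite (_ : (fun _ => _) = normal_pdf 0 t \o (fun yz : R * R => yz.2 - yz.1)).
  apply: measurableT_comp; first exact: measurable_normal_pdf.
  exact: measurable_funB.
by apply/funext => -[y z] /=; rewrite !normal_pdfE// /normal_fun subr0.
Qed.

Lemma measurable_normal_prob_mean (t : R) (B : set R) : t != 0 -> measurable B ->
  measurable_fun setT (fun y => normal_prob y t B).
Proof.
move=> t0 mB.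
have -> : (fun y => normal_prob y t B) =
    (fun y => \int[mu]_z ((normal_pdf y t z) * \1_B z)%:E)%E.
  by apply/funext => y; exact: normal_prob_indicE.
pose h (yz : R * R) : \bar R := (normal_pdf yz.1 t yz.2 * \1_B yz.2)%:E.
apply: (@measurable_fun_fubini_tonelli_F _ _ _ _ _ mu h).
  apply/measurable_EFinP; apply: measurable_funM; last first.
    by apply: measurableT_comp => //; exact: measurable_indic.
  exact: measurable_normal_pdf_pair.
by move=> yz; rewrite lee_fin mulr_ge0 ?normal_pdf_ge0// indicE.
Qed.

Lemma normal_prob_convolution (s t : R) (B : set R) : 0 < s -> 0 < t ->
  measurable B ->
  (\int[normal_prob 0 s]_y normal_prob y t B =
   normal_prob 0 (Num.sqrt (s ^+ 2 + t ^+ 2)) B)%E.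
Proof.
move=> s0 t0 mB; set r := Num.sqrt _.
have st0 : 0 < s ^+ 2 + t ^+ 2 by rewrite addr_gt0 ?exprn_gt0.
have r0 : 0 < r by rewrite sqrtr_gt0.
pose g (yz : R * R) : \bar R :=
  ((normal_pdf 0 s yz.1 * normal_pdf yz.1 t yz.2) * \1_B yz.2)%:E.
have mg : measurable_fun setT g.
  apply/measurable_EFinP; apply: measurable_funM; last first.
    by apply: measurableT_comp => //; exact: measurable_indic.
  apply: measurable_funM.
    by apply: measurableT_comp => //; exact: measurable_normal_pdf.
  by apply: measurable_normal_pdf_pair; rewrite gt_eqF.
have g0 yz : (0 <= g yz)%E.
  by rewrite lee_fin !mulr_ge0 ?normal_pdf_ge0// indicE.
rewrite ge0_integral_normal_prob//; last first.
  by apply: measurable_normal_prob_mean => //; rewrite gt_eqF.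
transitivity (\int[mu]_y \int[mu]_z g (y, z))%E.
  apply: eq_integral => y _; rewrite normal_prob_indicE muleC -ge0_integralZl//.
  - by apply: eq_integral => z _; rewrite /g /= -EFinM mulrA.
  - apply/measurable_EFinP/measurable_funM; first exact: measurable_normal_pdf.
    exact: measurable_indic.
  - by move=> z _; rewrite lee_fin mulr_ge0 ?normal_pdf_ge0// indicE.
  - by rewrite lee_fin normal_pdf_ge0.
rewrite -[LHS]/(\int[mu]_y fubini_F mu g y)%E -fubini_tonelli1// fubini_tonelli2//.
rewrite /normal_prob [RHS]integral_mkcond; apply: eq_integral => z _.
rewrite epatch_indic /= /fubini_G /g /=.
under eq_integral do rewrite normal_pdf_mul// mulrAC EFinM.
rewrite ge0_integralZl//.
- by rewrite integral_normal_pdf mule1 EFinM.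
- by apply/measurable_EFinP; exact: measurable_normal_pdf.
- by move=> y _; rewrite lee_fin normal_pdf_ge0.
- by rewrite lee_fin mulr_ge0 ?normal_pdf_ge0// indicE.
Qed.

(** The bound is uniform in the mean [y], which is what conditioning on a partial sum requires. *)
Lemma normal_prob_itv_ub (y s e : R) : s != 0 -> 0 <= e ->
  (normal_prob y s `[(- e)%R, e] <= (2 * e * normal_peak s)%R%:E)%E.
Proof.
move=> s0 e0.
apply: (@le_trans _ _ (\int[mu]_(x in `[(- e)%R, e]) (normal_peak s)%:E)%E).
  apply: ge0_le_integral => //=.
  - by move=> x _; rewrite lee_fin normal_pdf_ge0.
  - apply/measurable_EFinP/measurable_funTS; exact: measurable_normal_pdf.
  - by move=> x _; rewrite lee_fin normal_pdf_ub.
rewrite integral_cst//= lebesgue_measure_itv/= lte_fin.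
case: ifP => _; rewrite ?mule0 ?lee_fin -?EFinB -?EFinM ?lee_fin; last first.
  by rewrite !mulr_ge0 ?normal_peak_ge0.
by rewrite [leLHS](_ : _ = 2 * e * normal_peak s)//; lra.
Qed.

(** The density is smallest at the endpoints. Together with the upper bound this determines the
    probability up to a relative error of about [e^2 / (2 s^2)]. *)
Lemma normal_prob_itv_lb (s e : R) : s != 0 -> 0 <= e ->
  ((2 * e * normal_peak s * expR (- e ^+ 2 / (s ^+ 2 *+ 2)))%R%:E <=
    normal_prob 0 s `[(- e)%R, e])%E.
Proof.
move=> s0 e0; set c := expR _.
apply: (@le_trans _ _ (\int[mu]_(x in `[(- e)%R, e]) (normal_peak s * c)%R%:E)%E).
  rewrite integral_cst//= lebesgue_measure_itv/= lte_fin.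
  case: ifP => [_|/negbT]; first by rewrite -EFinB -EFinM lee_fin; lra.
  rewrite -leNgt => eN; have -> : e = 0 by lra.
  by rewrite mulr0 !mul0r mule0.
apply: ge0_le_integral => //=.
- by move=> x _; rewrite lee_fin mulr_ge0 ?normal_peak_ge0 ?expR_ge0.
- apply/measurable_EFinP/measurable_funTS; exact: measurable_normal_pdf.
- move=> x; rewrite in_itv/= => /andP[xl xr].
  rewrite lee_fin normal_pdfE// ler_wpM2l ?normal_peak_ge0// /normal_fun ler_expR.
  rewrite ler_wpM2r ?invr_ge0 ?mulrn_wge0 ?sqr_ge0// lerN2 subr0.
  by rewrite -real_normK ?num_real// lerXn2r ?nnegrE// ler_norml xl.
Qed.

(** Half of the exponent [x^2 / 2] is spent on the bound [x^2 >= e^2]; the other half is the density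
    of variance 2, of total mass 1. The factor [sqrt 2] is the ratio of the peaks. *)
Lemma normal_prob_tail (e : R) : 0 <= e ->
  (normal_prob 0 1 (~` `[(- e)%R, e]) <= (Num.sqrt 2 * expR (- e ^+ 2 / 4))%R%:E)%E.
Proof.
move=> e0; have s20 : Num.sqrt 2 != 0 :> R by rewrite gt_eqF// sqrtr_gt0.
set c := expR _.
apply: (@le_trans _ _ (\int[mu]_(x in ~` `[(- e)%R, e])
    ((Num.sqrt 2 * c)%R%:E * (normal_pdf 0 (Num.sqrt 2) x)%:E))%E).
  apply: ge0_le_integral => //=.
  - exact: measurableC.
  - by move=> x _; rewrite lee_fin normal_pdf_ge0.
  - apply/measurable_EFinP/measurable_funTS; exact: measurable_normal_pdf.
  - apply/measurable_EFinP/measurable_funTS/measurable_funM => //.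
    exact: measurable_normal_pdf.
  - move=> x; rewrite in_itv/= => xe.
    rewrite -EFinM lee_fin !normal_pdfE// ?oner_neq0//.
    have -> : normal_peak 1 = Num.sqrt 2 * normal_peak (Num.sqrt 2) :> R.
      rewrite /normal_peak expr1n mul1r sqr_sqrtr//.
      rewrite -mulrnAr sqrtrM// invfM mulrA divff//.
      by rewrite mul1r.
    rewrite [leRHS]mulrACA ler_wpM2l ?mulr_ge0 ?normal_peak_ge0 ?sqrtr_ge0//.
    rewrite /normal_fun /c -expRD ler_expR sqr_sqrtr// expr1n !subr0.
    have : e ^+ 2 <= x ^+ 2.
      rewrite -[x ^+ 2]real_normK ?num_real// lerXn2r ?nnegrE//.
      rewrite leNgt; apply/negP; rewrite ltr_norml => /andP[/ltW h1 /ltW h2].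
      by apply: xe; rewrite h1.
    lra.
rewrite ge0_integralZl//; last 4 first.
- exact: measurableC.
- apply/measurable_EFinP/measurable_funTS; exact: measurable_normal_pdf.
- by move=> x _; rewrite lee_fin normal_pdf_ge0.
- by rewrite lee_fin mulr_ge0 ?expR_ge0.
rewrite -[leRHS]mule1 lee_pmul2l// ?lte_fin ?mulr_gt0 ?expR_gt0//.
  by apply: (@probability_le1 _ _ _ (normal_prob 0 (Num.sqrt 2))); exact: measurableC.
Qed.

End normal_sums.

(** * Integrating out one of two independent variables *)

Section joint_law.
Context {R : realType} {d d' : measure_display} {T : measurableType d}
  {T1 : measurableType d'}.
Variables (P : probability T R) (Y : T -> T1) (V : T -> R).
Hypotheses (mY : measurable_fun setT Y) (mV : measurable_fun setT V).
Hypothesis indepYV : forall A B, measurable A -> measurable B ->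
  P (Y @^-1` A `&` V @^-1` B) = (P (Y @^-1` A) * P (V @^-1` B))%E.

(** Independence on rectangles identifies the law of the pair with the product of the laws, whose
    value on [D] is the integral of the measures of its sections. *)
Lemma independent_prob_integral (D : set (T1 * R)) : measurable D ->
  P [set w | D (Y w, V w)] = (\int[P]_w P [set w' | D (Y w, V w')])%E.
Proof.
move=> mD.
pose Y' : {mfun T >-> T1} := HB.pack Y (isMeasurableFun.Build _ _ _ _ _ mY).
pose V' : {mfun T >-> R} := HB.pack V (isMeasurableFun.Build _ _ _ _ _ mV).
pose YV w := (Y w, V w).
have mYV : measurable_fun setT YV by exact: measurable_fun_pair.
pose YV' : {mfun T >-> (T1 * R)%type} := HB.pack YV (isMeasurableFun.Build _ _ _ _ _ mYV).
have := @product_measure_unique _ _ _ _ _ (distribution P Y') (distribution P V')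
  (distribution P YV').
rewrite /distribution /pushforward /= => h.
rewrite -[LHS]h// => {h}.
rewrite [LHS](_ : _ = \int[distribution P Y']_y (distribution P V' \o xsection D) y)%E//.
rewrite ge0_integral_distribution//.
  by apply: eq_integral => w _ /=; congr (P _); apply/seteqP; split=> v;
    rewrite /xsection /= inE.
exact: measurable_fun_xsection.
Qed.

End joint_law.

(** * Sums over subsets of an independent Gaussian family *)

Section gaussian_family.
Context {R : realType} {d : measure_display} {T : measurableType d}.
Variables (P : probability T R) (I : finType) (X : I -> {RV P >-> R}).
Hypothesis indepX : mutually_independent X.
Hypothesis gaussX : forall i, standard_gaussian (X i).

Definition sum_over (J : {set I}) (w : T) : R := \sum_(i in J) X i w.

(** Measurability refers to the sigma-algebra generated by [J], not merely to that of [T]: this is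
    how events about sums enter the independence statements. *)
Lemma sigma_of_measurable_sum (J J' : {set I}) : J' \subset J ->
  measurable_fun (setT : set (g_sigma_algebraType (cylinder X J))) (sum_over J').
Proof.
move=> /fintype.subsetP J'J; rewrite /sum_over.
rewrite (_ : (fun _ => _) = fun w => \sum_(i <- enum J') X i w); last first.
  by apply/funext => w; rewrite big_enum.
have : {subset enum J' <= J} by move=> i; rewrite mem_enum; exact: J'J.
elim: (enum J') => [_|i s IH sJ].
  by rewrite (_ : (fun _ => _) = cst 0) //; apply/funext => w; rewrite big_nil.
rewrite (_ : (fun _ => _) = X i \+ (fun w => \sum_(i <- s) X i w)); last first.
  by apply/funext => w; rewrite big_cons.
apply: measurable_funD; first by apply: measurable_sigma_of_RV; apply: sJ; rewrite mem_head.
by apply: IH => j js; apply: sJ; rewrite inE js orbT.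
Qed.

Lemma sigma_of_sum (J J' : {set I}) (B : set R) : J' \subset J -> measurable B ->
  sigma_of X J (sum_over J' @^-1` B).
Proof.
by move=> J'J mB; rewrite -[_ @^-1` _]setTI; exact: sigma_of_measurable_sum.
Qed.

Lemma measurable_sum_over (J : {set I}) : measurable_fun setT (sum_over J).
Proof.
move=> _ B mB; rewrite setTI.
by apply: (@measurable_sigma_of _ _ _ P _ X J); exact: sigma_of_sum.
Qed.

Lemma sum_over_normal (J : {set I}) (B : set R) : (0 < #|J|)%N -> measurable B ->
  P (sum_over J @^-1` B) = normal_prob 0 (Num.sqrt #|J|%:R) B.
Proof.
move: {2}#|J| (erefl #|J|) => n; elim: n J B => [|n IH] J B; first by move=> ->.
move=> Jn _ mB; have /card_gt0P[i iJ] : (0 < #|J|)%N by rewrite Jn.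
have Xi A : measurable A -> P (X i @^-1` A) = normal_prob 0 1 A.
  by move=> mA; exact: gaussX.
have J'n : #|J :\ i| = n by move: Jn; rewrite (finset.cardsD1 i) iJ => -[].
have sumE w : sum_over J w = sum_over (J :\ i) w + X i w.
  by rewrite /sum_over (big_setD1 i)//= addrC.
(* A single variable is the true base case: the empty remainder would have deviation 0, outside the
   scope of the convolution formula. *)
have [n0|n0] := posnP n.
  rewrite Jn n0 sqrtr1 -Xi//; congr (P _); apply/funext => w /=.
  congr B; rewrite sumE /sum_over big1 ?add0r// => j.
  by move: J'n; rewrite n0 => /eqP; rewrite finset.cards_eq0 => /eqP ->; rewrite inE.
have mi : measurable_fun setT (X i) by [].
have indep A C : measurable A -> measurable C ->
    P (sum_over (J :\ i) @^-1` A `&` X i @^-1` C) =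
    (P (sum_over (J :\ i) @^-1` A) * P (X i @^-1` C))%E.
  move=> mA mC; apply: (sigma_of_independent (J := J :\ i) (J' := [set i]%SET) indepX).
  - by rewrite disjoint_sym disjoints1 !inE eqxx.
  - exact: sigma_of_sum.
  - rewrite -[_ @^-1` _]setTI; apply: measurable_sigma_of_RV => //.
    by rewrite finset.set11.
have mD : measurable [set yv : R * R | B (yv.1 + yv.2)].
  rewrite (_ : [set _ | _] = (fun yv : R * R => yv.1 + yv.2) @^-1` B)//.
  by rewrite -[_ @^-1` _]setTI; apply: measurable_funD.
have := independent_prob_integral (measurable_sum_over (J :\ i)) mi indep mD.
rewrite /= => h.
rewrite (_ : _ @^-1` _ = [set w | B (sum_over (J :\ i) w + X i w)]); last first.
  by apply/funext => w /=; rewrite sumE.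
rewrite h.
have s1 : (1 : R) != 0 by exact: oner_neq0.
under eq_integral => w _.
  have -> : P [set w' | B (sum_over (J :\ i) w + X i w')] =
      normal_prob (sum_over (J :\ i) w) 1 B.
    rewrite -normal_prob_translation// -Xi//.
    rewrite -[_ @^-1` _]setTI; apply: (measurable_funD _ _) => //.
  over.
pose S' : {mfun T >-> R} := HB.pack (sum_over (J :\ i))
  (isMeasurableFun.Build _ _ _ _ _ (measurable_sum_over (J :\ i))).
rewrite -[LHS](@ge0_integral_distribution _ _ _ _ _ P S' (fun y => normal_prob y 1 B))//; last first.
  exact: measurable_normal_prob_mean.
pose N := @normal_prob R 0 (Num.sqrt #|J :\ i|%:R).
pose idR : measurableTypeR R -> R := idfun.
have mid : measurable_fun setT idR by move=> _ A mA; rewrite setTI.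
(* The identity [idR] only moves the law from [measurableTypeR R] to [R]. *)
transitivity (\int[pushforward N idR]_y normal_prob y 1 B)%E.
  apply: eq_measure_integral => A mA _.
  by rewrite [RHS](_ : _ = N A)// /N -IH ?J'n.
rewrite ge0_integral_pushforward//; last exact: measurable_normal_prob_mean.
rewrite preimage_setT /comp /N /=.
have sn0 : 0 < Num.sqrt #|J :\ i|%:R :> R by rewrite sqrtr_gt0 J'n ltr0n.
have := normal_prob_convolution sn0 ltr01 mB.
have -> : Num.sqrt #|J :\ i|%:R ^+ 2 + 1 ^+ 2 = #|J|%:R :> R.
  by rewrite sqr_sqrtr ?ler0n// expr1n J'n natr1 Jn.
exact.
Qed.

Lemma sum_over_itv_ub (J : {set I}) (y e : R) : (0 < #|J|)%N -> 0 <= e ->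
  (P [set w | (`|y + sum_over J w| <= e)%R] <=
    (2 * e * normal_peak (Num.sqrt #|J|%:R))%R%:E)%E.
Proof.
move=> J0 e0.
have s0 : Num.sqrt #|J|%:R != 0 :> R by rewrite gt_eqF// sqrtr_gt0 ltr0n.
have mB : measurable ((fun x => y + x) @^-1` `[- e, e]).
  by rewrite -[_ @^-1` _]setTI; apply: measurable_funD.
rewrite [X in P X](_ : _ = sum_over J @^-1` ((fun x => y + x) @^-1` `[- e, e])); last first.
  by apply/seteqP; split=> w /=; rewrite in_itv/= ler_norml.
rewrite sum_over_normal// (normal_prob_translation _ s0)//.
exact: normal_prob_itv_ub.
Qed.

(* Conditionally on [sum_over J], the sum over the rest of [J'] still has a
   Gaussian density. *)
Lemma sum_over_pair_ub (J J' : {set I}) (e : R) : (0 < #|J' :\: J|)%N -> 0 <= e ->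
  (P ([set w | (`|sum_over J w| <= e)%R] `&` [set w | (`|sum_over J' w| <= e)%R]) <=
   P [set w | (`|sum_over J w| <= e)%R] *
     (2 * e * normal_peak (Num.sqrt #|J' :\: J|%:R))%R%:E)%E.
Proof.
move=> JJ' e0; set b := (2 * e * _)%R.
have b0 : 0 <= b by rewrite !mulr_ge0 ?normal_peak_ge0.
(* Recording the shared part as well makes both events functions of [Y] and of the sum over
   [J' :\: J], which is independent of [Y]. *)
pose Y w := (sum_over J w, sum_over (J' :&: J) w).
have sY : measurable_fun (setT : set (g_sigma_algebraType (cylinder X J))) Y.
  apply: measurable_fun_pair; apply: sigma_of_measurable_sum => //.
  exact: finset.subsetIr.
have mY : measurable_fun setT Y.
  by apply: measurable_fun_pair; exact: measurable_sum_over.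
have indep A C : measurable A -> measurable C ->
    P (Y @^-1` A `&` sum_over (J' :\: J) @^-1` C) =
    (P (Y @^-1` A) * P (sum_over (J' :\: J) @^-1` C))%E.
  move=> mA mC; apply: (sigma_of_independent (J := J) (J' := J' :\: J) indepX).
  - by rewrite -setI_eq0 finset.setIC finset.setDE -finset.setIA (finset.setIC _ J) finset.setICr finset.setI0.
  - by rewrite -[_ @^-1` _]setTI; exact: sY.
  - exact: sigma_of_sum.
pose D := [set yv : R * R * R | (`|yv.1.1| <= e) && (`|yv.1.2 + yv.2| <= e)].
have mD : measurable D.
  rewrite (_ : D = (fun yv : R * R * R => (`|yv.1.1| <= e) && (`|yv.1.2 + yv.2| <= e)) @^-1` [set true])//.
  rewrite -[_ @^-1` _]setTI.
  have mf : measurable_fun setT (fun yv : R * R * R => (`|yv.1.1| <= e) && (`|yv.1.2 + yv.2| <= e)).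
    apply: measurable_and; apply: measurable_fun_ler => //.
      apply: measurableT_comp => //; exact: measurableT_comp.
    apply: measurableT_comp => //; apply: measurable_funD => //.
    exact: measurableT_comp.
  exact: mf.
have := independent_prob_integral mY (measurable_sum_over (J' :\: J)) indep mD.
have -> : [set w | D (Y w, sum_over (J' :\: J) w)] =
    [set w | (`|sum_over J w| <= e)%R] `&` [set w | (`|sum_over J' w| <= e)%R].
  have sumE w : sum_over J' w = sum_over (J' :&: J) w + sum_over (J' :\: J) w.
    by rewrite /sum_over (big_setID J).
  by apply/seteqP; split=> w; rewrite /D/= sumE => /andP.
move=> ->.
have mJ : measurable [set w | (`|sum_over J w| <= e)%R].
  rewrite (_ : [set _ | _] = (fun w => `|sum_over J w| <= e) @^-1` [set true])//.
  rewrite -[_ @^-1` _]setTI.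
  have mf : measurable_fun setT (fun w => `|sum_over J w| <= e).
    by apply: measurable_fun_ler => //; apply: measurableT_comp => //; exact: measurable_sum_over.
  exact: mf.
apply: (@le_trans _ _ (\int[P]_w (b%:E * (\1_[set w | (`|sum_over J w| <= e)%R] w)%:E))%E); last first.
  rewrite ge0_integralZl//.
  - by rewrite integral_indic// setIT muleC.
  - by apply/measurable_EFinP; exact: measurable_indic.
apply: ge0_le_integral => //.
- pose V : {mfun T >-> R} := HB.pack (sum_over (J' :\: J))
    (isMeasurableFun.Build _ _ _ _ _ (measurable_sum_over (J' :\: J))).
  have mx : measurable_fun setT (fun y => P [set w' | D (y, V w')]).
    have := measurable_fun_xsection (distribution P V) mD.
    rewrite (_ : _ \o _ = (fun y => P [set w' | D (y, V w')]))//.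
    apply/funext => y /=; congr (P _); apply/seteqP.
    by split=> w; rewrite /xsection /= inE.
  exact: measurableT_comp mx mY.
- apply/measurable_EFinP/measurable_funM => //; exact: measurable_indic.
- move=> w _; rewrite indicE /D /=.
  have [wJ|wJ] := boolP (`|sum_over J w| <= e); last first.
    rewrite memNset//=; last exact/negP.
    by rewrite mule0 [X in P X](_ : _ = set0) ?measure0// -subset0 => v.
  rewrite mem_set//= mule1.
  exact: sum_over_itv_ub.
Qed.

End gaussian_family.

(** * A second moment bound for the union of finitely many events *)

Section second_moment.
Context {R : realType} {d : measure_display} {T : measurableType d}.
Variables (P : probability T R) (S : finType) (G : S -> set T).
Hypothesis mG : forall s, measurable (G s).

(* With [Z] the number of events that occur, [2 t Z - t^2 Z^2 <= 1] and the left
   side vanishes when [Z = 0]. *)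
Lemma second_moment_union (t : R) : 0 <= t ->
  ((2 * t)%R%:E * (\sum_(s : S) P (G s)) <= P (\bigcup_(s in setT) G s) +
    (t ^+ 2)%R%:E * (\sum_(s : S) \sum_(s' : S) P (G s `&` G s')))%E.
Proof.
move=> t0.
have mU : measurable (\bigcup_(s in setT) G s).
  by apply: fin_bigcup_measurable => // s _; exact: mG.
have iE A : measurable A -> P A = (\int[P]_w (\1_A w)%:E)%E.
  by move=> mA; rewrite integral_indic// setIT.
have mI A : measurable A -> measurable_fun setT (EFin \o (\1_A : T -> R)).
  by move=> mA; apply/measurable_EFinP; exact: measurable_indic.
have mGG s s' : measurable (G s `&` G s') by exact: measurableI.
have I0 (A : set T) w : (0 <= (\1_A w)%:E :> \bar R)%E by rewrite lee_fin indicE.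
rewrite [in leLHS](eq_bigr (fun s => \int[P]_w (\1_(G s) w)%:E)%E) => [|s _]; last exact: iE.
rewrite -ge0_integral_sum//; last by move=> s; exact: mI.
rewrite -ge0_integralZl//; last 3 first.
- by apply: emeasurable_sum => s; exact: mI.
- by move=> w _; apply: sume_ge0 => s _.
- by rewrite lee_fin mulr_ge0.
rewrite [in leRHS](eq_bigr (fun s => \int[P]_w (\sum_(s' : S) (\1_(G s `&` G s') w)%:E))%E) => [|s _]; last first.
  rewrite ge0_integral_sum//; last by move=> s'; exact: mI.
  by apply: eq_bigr => s' _; exact: iE.
have mS s : measurable_fun setT (fun w => \sum_(s' : S) ((\1_(G s `&` G s') w) : R)%:E)%E.
  by apply: emeasurable_sum => s'; exact: mI.
have S0 s w : (0 <= \sum_(s' : S) (\1_(G s `&` G s') w)%:E :> \bar R)%E.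
  by apply: sume_ge0 => s' _.
rewrite -ge0_integral_sum//.
rewrite -ge0_integralZl//; last 3 first.
- exact: emeasurable_sum.
- by move=> w _; apply: sume_ge0 => s _.
- by rewrite lee_fin sqr_ge0.
rewrite iE// -ge0_integralD//; last 3 first.
- exact: mI.
- by move=> w _; rewrite mule_ge0 ?lee_fin ?sqr_ge0//; apply: sume_ge0.
- by apply: measurable_funeM; exact: emeasurable_sum.
apply: ge0_le_integral => //.
- by move=> w _; rewrite mule_ge0 ?lee_fin ?mulr_ge0//; apply: sume_ge0.
- by apply: measurable_funeM; apply: emeasurable_sum => s; exact: mI.
- by apply: emeasurable_funD; [exact: mI|apply: measurable_funeM; exact: emeasurable_sum].
move=> w _.
under [in leRHS]eq_bigr do rewrite sumEFin.
rewrite !sumEFin -!EFinM -EFinD lee_fin.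
set Z := \sum_(s : S) \1_(G s) w.
have -> : \sum_(s : S) \sum_(s' : S) \1_(G s `&` G s') w = Z ^+ 2 :> R.
  rewrite expr2 mulr_suml; apply: eq_bigr => s _.
  by rewrite mulr_sumr; apply: eq_bigr => s' _; rewrite indicI.
rewrite [X in _ <= X + _]indicE; have [wU|wU] := boolP (w \in _).
  have := sqr_ge0 (1 - t * Z); rewrite !expr2/=; nra.
suff -> : Z = 0 by rewrite expr0n/= !mulr0 addr0.
rewrite /Z big1// => s _; rewrite indicE memNset// => Gw.
by move/negP: wU; apply; rewrite inE; exists s.
Qed.

Lemma second_moment_half (q : R) (F : S -> S -> R) : 0 < q -> (0 < #|S|)%N ->
  (forall s, P (G s) = q%:E) ->
  (forall s s', P (G s `&` G s') <= (q ^+ 2 * F s s')%R%:E)%E ->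
  (forall s, \sum_(s' : S) F s s' <= 3 / 2 * #|S|%:R) ->
  ((1 / 2)%R%:E <= P (\bigcup_(s in setT) G s))%E.
Proof.
move=> q0 S0 PG PGG FS.
have N0 : 0 < #|S|%:R :> R by rewrite ltr0n.
(* The reciprocal of the expected number of events: the left side becomes 2 and the quadratic term
   at most [3 / 2], leaving [1 / 2]. *)
pose t := (#|S|%:R * q)^-1.
have t0 : 0 <= t by rewrite invr_ge0 mulr_ge0// ltW.
have mU : measurable (\bigcup_(s in setT) G s).
  by apply: fin_bigcup_measurable => // s _; exact: mG.
have := second_moment_union t0.
have -> : (\sum_(s : S) P (G s) = (#|S|%:R * q)%R%:E)%E.
  by under eq_bigr do rewrite PG; rewrite sumEFin sumr_const mulr_natl.
rewrite -EFinM.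
have -> : 2 * t * (#|S|%:R * q) = 2 by rewrite /t -mulrA mulVf ?mulr1// mulf_neq0// gt_eqF.
have le2 : (\sum_(s : S) \sum_(s' : S) P (G s `&` G s') <=
    (q ^+ 2 * (3 / 2 * #|S|%:R ^+ 2))%R%:E)%E.
  apply: (@le_trans _ _ (\sum_(s : S) \sum_(s' : S) (q ^+ 2 * F s s')%R%:E)%E).
    by apply: lee_sum => s _; apply: lee_sum => s' _.
  rewrite (eq_bigr (fun s => (q ^+ 2 * \sum_(s' : S) F s s')%R%:E)) => [|s _]; last first.
    by rewrite sumEFin mulr_sumr.
  rewrite sumEFin lee_fin -mulr_sumr ler_wpM2l ?sqr_ge0//.
  apply: (@le_trans _ _ (\sum_(s : S) (3 / 2 * #|S|%:R))).
    by apply: ler_sum => s _; exact: FS.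
  by rewrite sumr_const -[leLHS]mulr_natr expr2 mulrA lexx.
have {}le2 : ((t ^+ 2)%R%:E * (\sum_(s : S) \sum_(s' : S) P (G s `&` G s')) <= (3 / 2)%R%:E)%E.
  apply: (@le_trans _ _ ((t ^+ 2)%R%:E * (q ^+ 2 * (3 / 2 * #|S|%:R ^+ 2))%R%:E)%E).
    by rewrite lee_wpmul2l// lee_fin sqr_ge0.
  rewrite -EFinM lee_fin /t exprVn exprMn.
  by rewrite le_eqVlt; apply/orP; left; apply/eqP; field; rewrite !gt_eqF.
move=> h; have := le_trans h (leeD2l _ le2).
rewrite -(fineK (fin_num_measure P _ mU)) -EFinD !lee_fin; lra.
Qed.

End second_moment.

(** * Generating function of the overlap of two choices *)

Section agreement.
Context {R : realType}.

Definition agree {K B : nat} (s s' : {ffun 'I_K -> 'I_B}) : {set 'I_K} :=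
  [set b | s b == s' b]%SET.

(** The summand is a product over blocks, so the sum factorizes: in each block one value agrees and
    contributes [x], the other [B - 1] contribute 1. *)
Lemma sum_agree (K B : nat) (x : R) (s : {ffun 'I_K -> 'I_B}) :
  \sum_(s' : {ffun 'I_K -> 'I_B}) x ^+ #|agree s s'| = (x + B.-1%:R) ^+ K.
Proof.
transitivity (\prod_(b < K) \sum_(i < B) (if s b == i then x else 1)).
  rewrite bigA_distr_bigA; apply: eq_bigr => s' _.
  rewrite -big_mkcond /= prodr_const; congr (_ ^+ _).
  by apply: eq_card => b; rewrite inE.
rewrite (eq_bigr (fun=> x + B.-1%:R)) => [|b _]; first by rewrite prodr_const card_ord.
rewrite (bigD1 (s b))//= eqxx; congr (_ + _).
rewrite (eq_bigr (fun=> 1)) => [|i]; last by rewrite eq_sym => /negbTE ->.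
rewrite sumr_const; congr (_%:R).
have := cardC1 (s b); rewrite card_ord => <-.
by apply: eq_card => i; rewrite !inE.
Qed.

End agreement.

(** * Correlation of two choices as a function of their overlap *)

Section pair_factor.
Context {R : realType}.

(** With [x = N / K] this is [1 / sqrt (1 - x) <= 1 + x], that is [(1 + x)^2 (1 - x) >= 1], valid
    for [0 <= x <= 1 / 2]. *)
Lemma normal_peak_ratio (K N : nat) : (0 < K)%N -> (2 * N <= K)%N ->
  normal_peak (Num.sqrt (K - N)%:R) <=
    normal_peak (Num.sqrt K%:R) * (1 + N%:R / K%:R) :> R.
Proof.
move=> K0 NK.
have KR : 0 < K%:R :> R by rewrite ltr0n.
have NK' : (N <= K)%N by lia.
have KNR : 0 < (K - N)%:R :> R by rewrite ltr0n; lia.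
have ppi := @pi_gt0 R.
rewrite /normal_peak !sqr_sqrtr ?ler0n//.
have sK : 0 < Num.sqrt (K%:R * pi *+ 2) :> R.
  by rewrite sqrtr_gt0 pmulrn_lgt0// mulr_gt0.
have sKN : 0 < Num.sqrt ((K - N)%:R * pi *+ 2) :> R.
  by rewrite sqrtr_gt0 pmulrn_lgt0// mulr_gt0.
set x := N%:R / K%:R.
have x0 : 0 <= x by rewrite divr_ge0.
have x2 : x <= 2^-1.
  rewrite /x ler_pdivrMr// mulrC ler_pdivlMr// mulrC.
  by rewrite -natrM ler_nat.
rewrite [leRHS]mulrC ler_pdivlMr// [leLHS]mulrC ler_pdivrMr//.
have y0 : 0 <= 1 + x by lra.
rewrite -[X in X * Num.sqrt _](ger0_norm y0) -sqrtr_sqr -sqrtrM ?sqr_ge0//.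
rewrite ler_sqrt; last first.
  by rewrite mulr_ge0 ?sqr_ge0// mulrn_wge0// mulr_ge0// ltW.
rewrite natrB//.
have -> : N%:R = x * K%:R by rewrite /x divfK// gt_eqF.
rewrite -!(mulrnAr _ pi).
rewrite [leRHS](_ : _ = (1 + x) ^+ 2 * (1 - x) * (K%:R * (pi *+ 2))); last by ring.
have c0 : 0 <= K%:R * (pi *+ 2) :> R by rewrite mulr_ge0// mulrn_wge0// pi_ge0.
rewrite -[leLHS]mul1r ler_wpM2r//.
have d0 : 0 <= 2^-1 - x by lra.
have := mulr_ge0 x0 d0; have := mulr_ge0 (sqr_ge0 x) d0.
rewrite !expr2; lra.
Qed.

(** Bounds the joint probability divided by the product of the two. The first term serves
    [2 N <= K]. The second serves [2 N > K], where [B^N / sqrt B ^ K >= 1] only enlarges the crude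
    bound [expR (4 m b)]. Adding the terms instead of splitting cases keeps each geometric in [N],
    so that [sum_agree] applies. *)
Definition overlap_factor (m K B N : nat) (e : R) : R :=
  let b := 2 * e * normal_peak (Num.sqrt K%:R) in
  expR (4 * m%:R * b ^+ 2 / K%:R * (e ^+ 2 / 2)) *
    expR (4 * m%:R * b ^+ 2 / K%:R) ^+ N +
  expR (4 * m%:R * b) * (Num.sqrt B%:R)^-1 ^+ K * B%:R ^+ N.

Lemma pair_factor (m K B N : nat) (e p pb : R) :
  (0 < K)%N -> (N <= K)%N -> (0 < B)%N -> 0 <= e ->
  let b := 2 * e * normal_peak (Num.sqrt K%:R) in
  b <= 1 / 2 -> b * expR (- e ^+ 2 / (K%:R *+ 2)) <= p -> p <= b ->
  0 <= pb -> pb <= p ->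
  ((N < K)%N -> pb <= p * (2 * e * normal_peak (Num.sqrt (K - N)%:R))) ->
  (1 - 2 * p + pb) ^+ m <= ((1 - p) ^+ m) ^+ 2 * overlap_factor m K B N e.
Proof.
move=> K0 NK; have NltK : (2 * N <= K)%N -> (N < K)%N by lia.
move=> B0 e0 b b12 pl pu pb0 pbp pbN.
have KR : 0 < K%:R :> R by rewrite ltr0n.
have BR : 0 < B%:R :> R by rewrite ltr0n.
have bE : b = 2 * e * normal_peak (Num.sqrt K%:R) by [].
have b0 : 0 <= b by rewrite !mulr_ge0 ?normal_peak_ge0.
rewrite /overlap_factor -bE; clearbody b.
have p0 : 0 <= p by exact: le_trans pb0 pbp.
have h0 : 0 <= 1 - 2 * p + pb by lra.
(* In one row [1 - 2 p + pb <= (1 - p)^2 + Q], and [(1 - p)^2 >= 1 / 4] turns the excess [Q] into a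
   factor [1 + 4 Q <= expR (4 Q)]. *)
have key (Q : R) : 0 <= Q -> pb <= p ^+ 2 + Q ->
    (1 - 2 * p + pb) ^+ m <= ((1 - p) ^+ m) ^+ 2 * expR (4 * m%:R * Q).
  move=> Q0 pQ; rewrite -mulrA mulrCA expRM_natl -!exprM mulnC exprM -exprMn.
  apply: lerXn2r; rewrite ?nnegrE; [exact: h0|by rewrite mulr_ge0 ?sqr_ge0 ?expR_ge0|].
  apply: (@le_trans _ _ ((1 - p) ^+ 2 * (1 + 4 * Q))); last first.
    by rewrite ler_wpM2l ?sqr_ge0 ?expR_ge1Dx.
  have q4 : 1 / 4 <= (1 - p) ^+ 2 by nra.
  have := ler_wpM2r Q0 q4; lra.
rewrite mulrDr.
have f0 : 0 <= ((1 - p) ^+ m) ^+ 2 by rewrite sqr_ge0.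
have [NK2|NK2] := leqP (2 * N) K.
  rewrite -[leLHS]addr0 lerD//; last first.
    by do ?[exact: f0|exact: expR_ge0|apply: mulr_ge0|apply: exprn_ge0]; rewrite ?invr_ge0 ?sqrtr_ge0.
  (* The first summand is the loss of variance caused by the shared entries, the second the gap
     between [p] and its linear approximation [b]. *)
  pose Q := b ^+ 2 * (N%:R / K%:R + e ^+ 2 / (K%:R *+ 2)).
  have Q0 : 0 <= Q.
    by rewrite mulr_ge0 ?sqr_ge0// addr_ge0 ?divr_ge0 ?mulrn_wge0 ?sqr_ge0.
  apply: le_trans (key Q Q0 _) _; last first.
    rewrite ler_wpM2l// -expRM_natl -expRD ler_expR le_eqVlt; apply/orP; left.
    by apply/eqP; rewrite /Q; field; rewrite gt_eqF.
  apply: le_trans (pbN (NltK NK2)) _.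
  have := normal_peak_ratio K0 NK2.
  move=> /(ler_wpM2l (mulr_ge0 (ler0n R 2) e0)); rewrite (mulrA (2 * e)) -bE.
  set bN := 2 * e * normal_peak (Num.sqrt (K - N)%:R); set x := N%:R / _ => hb.
  have := expR_ge1Dx (- e ^+ 2 / (K%:R *+ 2)).
  rewrite mulNr; rewrite mulNr in pl.
  set y := e ^+ 2 / (K%:R *+ 2); rewrite -/y in pl.
  have y0 : 0 <= y by rewrite divr_ge0 ?sqr_ge0 ?mulrn_wge0.
  have x0 : 0 <= x by rewrite divr_ge0.
  move=> hy.
  have plb : b * (1 - y) <= p by apply: le_trans pl; rewrite ler_wpM2l.
  have : bN - p <= b * (x + y) by rewrite mulrDr in hb; lra.
  move=> hbp.
  have : p * (bN - p) <= b * (b * (x + y)).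
    apply: le_trans (ler_wpM2l p0 hbp) _.
    by rewrite ler_wpM2r// mulr_ge0// addr_ge0.
  rewrite /Q -/x -/y; lra.
rewrite -[leLHS]add0r lerD//.
  by do ?[exact: f0|exact: expR_ge0|apply: mulr_ge0|apply: exprn_ge0].
apply: le_trans (key b b0 _) _; first by apply: le_trans pbp _; nra.
rewrite ler_wpM2l// -[leRHS]mulrA -[leLHS]mulr1 ler_wpM2l ?expR_ge0//.
have sB : 1 <= Num.sqrt B%:R :> R by rewrite -[leLHS]sqrtr1 ler_wsqrtr// ler1n.
rewrite -[X in _ * X ^+ N]sqr_sqrtr// -exprM exprVn mulrC ler_pdivlMr ?exprn_gt0//; last lra.
by rewrite mul1r ler_weXn2l// ltnW.
Qed.

End pair_factor.

(** * Some choice has large sums in all rows with probability at least one half *)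

Section separated_sums.
Context {R : realType} {d : measure_display} {T : measurableType d}.
Variables (P : probability T R) (m n K B : nat).
Variables (a : 'I_m * 'I_n -> {RV P >-> R}) (e : 'I_K * 'I_B -> 'I_n).
Hypotheses (iid : iid_standard_gaussian a) (inj_e : injective e).

Definition slots (s : {ffun 'I_K -> 'I_B}) (i : 'I_m) : {set 'I_m * 'I_n} :=
  [set (i, e (b, s b)) | b : 'I_K]%SET.

Lemma slot_inj (s : {ffun 'I_K -> 'I_B}) (i : 'I_m) : injective (fun b => (i, e (b, s b))).
Proof. by move=> b b' [/inj_e[]]. Qed.

Lemma card_slots s i : #|slots s i| = K.
Proof. by rewrite card_imset ?card_ord//; exact: slot_inj. Qed.

Lemma card_slotsD s s' i : #|slots s' i :\: slots s i| = (K - #|agree s s'|)%N.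
Proof.
have -> : slots s' i :\: slots s i = [set (i, e (b, s' b)) | b in ~: agree s s']%SET.
  apply/setP => z; rewrite !inE; apply/andP/imsetP.
    case=> zs /imsetP[b _ zE]; exists b => //; rewrite !inE.
    by apply: contraNN zs => /eqP sb; rewrite zE -sb; apply/imsetP; exists b.
  case=> b; rewrite !inE => sb ->; split; last by apply/imsetP; exists b.
  by apply: contraNN sb => /imsetP[b' _ [/inj_e[-> ->]]].
rewrite card_imset; last exact: slot_inj.
by have := finset.cardsC (agree s s'); rewrite card_ord => cK; rewrite -[X in (X - _)%N]cK addKn.
Qed.

Lemma disjoint_rows (i i' : 'I_m) : i != i' ->
  [disjoint [set z | z.1 == i]%SET & [set z : 'I_m * 'I_n | z.1 == i']%SET]%B.
Proof.
move=> ii'; rewrite -setI_eq0; apply/eqP/setP => z; rewrite !inE.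
apply/negbTE/negP => /andP[/eqP zi /eqP zi'].
by rewrite -zi -zi' eqxx in ii'.
Qed.

Lemma sub_slots s i : slots s i \subset [set z | z.1 == i]%SET.
Proof. by apply/fintype.subsetP => z /imsetP[b _ ->]; rewrite inE. Qed.

(** The last hypothesis bounds the sum of [overlap_factor] over all second choices, as evaluated by
    [sum_agree]. Distinct rows use disjoint entries, so single and joint probabilities are products
    over rows. *)
Lemma separated_sums_prob (t : R) :
  (0 < K)%N -> (0 < B)%N -> 0 <= t ->
  2 * t * normal_peak (Num.sqrt K%:R) <= 1 / 2 ->
  let b := 2 * t * normal_peak (Num.sqrt K%:R) in
  let A := 4 * m%:R * b ^+ 2 / K%:R in
  expR (A * (t ^+ 2 / 2)) * (expR A + B.-1%:R) ^+ K +
    expR (4 * m%:R * b) * (Num.sqrt B%:R)^-1 ^+ K * (B%:R + B.-1%:R) ^+ K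
    <= 3 / 2 * B%:R ^+ K ->
  ((1 / 2)%R%:E <= P (\bigcup_(s in [set: {ffun 'I_K -> 'I_B}])
     \bigcap_(i in [set: 'I_m]) [set w | (t < `|sum_over a (slots s i) w|)%R]))%E.
Proof.
move=> K0 B0 t0 b12 b A hF.
have [indep gauss] := iid.
pose small (s : {ffun 'I_K -> 'I_B}) i := [set w | (`|sum_over a (slots s i) w| <= t)%R].
have smallE s i : [set w | (t < `|sum_over a (slots s i) w|)%R] = ~` small s i.
  by apply/seteqP; split=> w; rewrite /small /= ltNge => /negP.
have sums J B' : measurable B' -> sigma_of a J (sum_over a J @^-1` B').
  by move=> mB'; exact: sigma_of_sum.
have smallT s i : small s i = sum_over a (slots s i) @^-1` `[- t, t].
  by apply/seteqP; split=> w; rewrite /small /= in_itv/= ler_norml.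
have ssmall s i : sigma_of a [set z | z.1 == i]%SET (small s i).
  rewrite smallT; apply: (@sub_sigma_of _ _ _ P _ a (slots s i)); first exact: sub_slots.
  exact: sums.
have slarge s i : sigma_of a [set z | z.1 == i]%SET (~` small s i).
  exact: (@measurableC _ (g_sigma_algebraType (cylinder a [set z | z.1 == i]%SET)) _ (ssmall s i)).
have mlarge s i : measurable (~` small s i).
  exact: measurable_sigma_of (slarge s i).
have msmall s i : measurable (small s i) by exact: measurable_sigma_of (ssmall s i).
have rows (E : 'I_m -> set T) : (forall i, sigma_of a [set z | z.1 == i]%SET (E i)) ->
    P (\bigcap_(i in [set: 'I_m]) E i) = (\prod_(i < m) P (E i))%E.
  move=> sE.
  have := @sigma_of_independent_seq _ _ _ P _ a indep _ (index_enum 'I_m)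
    (fun i => [set z | z.1 == i]%SET) E (index_enum_uniq _) disjoint_rows sE.
  by move=> <-; congr (P _); apply/seteqP; split=> w h i _; apply: h => //=;
    rewrite mem_index_enum.
pose p := fine (normal_prob 0 (Num.sqrt K%:R) (`[- t, t] : set R)).
have Psmall s i : P (small s i) = p%:E.
  rewrite smallT sum_over_normal// card_slots// /p fineK//.
  exact: fin_num_measure.
have Plarge s i : P (~` small s i) = (1 - p)%:E.
  by rewrite probability_setC// Psmall -EFinB.
under eq_bigcupr do under eq_bigcapr do rewrite smallE.
have pub : p <= b.
  have sK0 : Num.sqrt K%:R != 0 :> R by rewrite gt_eqF// sqrtr_gt0 ltr0n.
  rewrite -lee_fin /p fineK; first exact: normal_prob_itv_ub.
  exact: fin_num_measure.
have plb : b * expR (- t ^+ 2 / (K%:R *+ 2)) <= p.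
  have sK0 : Num.sqrt K%:R != 0 :> R by rewrite gt_eqF// sqrtr_gt0 ltr0n.
  rewrite -lee_fin /p fineK; last exact: fin_num_measure.
  by have := normal_prob_itv_lb sK0 t0; rewrite sqr_sqrtr.
have q0 : 0 < (1 - p) ^+ m by rewrite exprn_gt0//; rewrite -/b in b12; lra.
apply: (@second_moment_half _ _ _ P _ _ _ ((1 - p) ^+ m)
   (fun s s' => overlap_factor m K B #|agree s s'| t)) => //.
- by move=> s; apply: fin_bigcap_measurable => // i _; exact: mlarge.
- by apply/card_gt0P; exists [ffun=> Ordinal B0].
- move=> s; rewrite rows//; under eq_bigr do rewrite Plarge.
  by rewrite prodEFin prodr_const card_ord.
- move=> s s'.
  have -> : (\bigcap_(i in setT) ~` small s i) `&` (\bigcap_(i in setT) ~` small s' i) =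
      \bigcap_(i in setT) (~` small s i `&` ~` small s' i).
    by rewrite bigcapI.
  rewrite rows; last first.
    by move=> i; exact: (@measurableI _ (g_sigma_algebraType (cylinder a [set z | z.1 == i]%SET)) _ _ (slarge s i) (slarge s' i)).
  pose pb i := fine (P (small s i `&` small s' i)).
  have Ppb i : P (small s i `&` small s' i) = (pb i)%:E.
    by rewrite fineK//; apply: fin_num_measure; exact: measurableI.
  have pb0 i : 0 <= pb i by apply: fine_ge0.
  have pbp i : pb i <= p.
    by rewrite -lee_fin -Ppb -(Psmall s i) le_measure ?inE//; exact: measurableI.
  have NK : (#|agree s s'| <= K)%N by rewrite -[leqRHS]card_ord max_card.
  have pbN i : (#|agree s s'| < K)%N ->
      pb i <= p * (2 * t * normal_peak (Num.sqrt (K - #|agree s s'|)%:R)).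
    move=> ltK; rewrite -lee_fin -Ppb EFinM -(Psmall s i).
    have := @sum_over_pair_ub _ _ _ P _ a indep gauss (slots s i) (slots s' i) t.
    by rewrite card_slotsD subn_gt0; apply.
  have Prow i : P (~` small s i `&` ~` small s' i) = (1 - 2 * p + pb i)%:E.
    have e1 : ~` small s' i `\` small s i = ~` small s i `&` ~` small s' i.
      by rewrite setDE setIC.
    have e2 : ~` small s' i `&` small s i = small s i `\` small s' i.
      by rewrite setDE setIC.
    have h1 : P (~` small s' i) =
        (P (~` small s i `&` ~` small s' i) + P (small s i `\` small s' i))%E.
      by rewrite -e1 -e2; exact: measureDI.
    have h2 : P (small s i) =
        (P (small s i `\` small s' i) + P (small s i `&` small s' i))%E.
      exact: measureDI.
    rewrite Plarge in h1; rewrite Psmall Ppb in h2.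
    have f1 : P (~` small s i `&` ~` small s' i) \is a fin_num.
      by apply: fin_num_measure; exact: measurableI.
    have f2 : P (small s i `\` small s' i) \is a fin_num.
      by apply: fin_num_measure; exact: measurableD.
    move: h1 h2; rewrite -(fineK f1) -(fineK f2) -!EFinD => -[h1] [h2].
    by congr (_%:E); lra.
  under eq_bigr do rewrite Prow.
  rewrite prodEFin lee_fin.
  pose bN := 2 * t * normal_peak (Num.sqrt (K - #|agree s s'|)%:R).
  (* A common upper bound for all [pb i] turns the product over rows into an [m]-th power without
     comparing the joint laws of different rows. *)
  pose pbs := if (#|agree s s'| < K)%N then Num.min p (p * bN) else p.
  have p0 : 0 <= p by apply: fine_ge0.
  have pbsi i : pb i <= pbs.
    by rewrite /pbs; case: ifP => // ltK; rewrite le_min pbp pbN.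
  apply: (@le_trans _ _ (\prod_(i < m) (1 - 2 * p + pbs))).
    apply: ler_prod => i _; have := pbsi i; have := pb0 i.
    by rewrite -/b in b12; move=> ? ?; apply/andP; split; lra.
  rewrite prodr_const card_ord; apply: pair_factor => //.
  - rewrite /pbs; case: ifP => // ltK; rewrite le_min p0 mulr_ge0//.
    by rewrite !mulr_ge0 ?normal_peak_ge0.
  - by rewrite /pbs; case: ifP => // _; rewrite ge_min lexx.
  - by move=> ltK; rewrite /pbs ltK ge_min lexx orbT.
- move=> s; rewrite /overlap_factor -/b -/A big_split/= -!mulr_sumr !sum_agree.
  by rewrite card_ffun !card_ord natrX.
Qed.

End separated_sums.

(** * Measurability of the existence of a zero in a compact box *)

Section feasibility.
Context {R : realType} {d : measure_display} {T : measurableType d}.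

Lemma continuous_bigsum (U : topologicalType) (J : finType) (Q : pred J)
    (f : J -> U -> R) :
  (forall j, continuous (f j)) -> continuous (fun x => \sum_(j | Q j) f j x).
Proof.
move=> cf; rewrite (_ : (fun _ => _) = fun x => \sum_(j <- enum Q) f j x); last first.
  by apply/funext => x; rewrite big_enum.
elim: (enum Q) => [|j s IH].
  rewrite (_ : (fun _ => _) = cst 0); first by move=> x; exact: cvg_cst.
  by apply/funext => x; rewrite big_nil.
rewrite (_ : (fun _ => _) = (fun x => f j x + \sum_(i <- s) f i x)).
  by move=> x; apply: cvgD; [exact: cf|exact: IH].
by apply/funext => x; rewrite big_cons.
Qed.

Lemma measurable_bigsum (J : finType) (Q : pred J) (f : J -> T -> R) :
  (forall j, measurable_fun setT (f j)) ->
  measurable_fun setT (fun x => \sum_(j | Q j) f j x).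
Proof.
move=> cf; rewrite (_ : (fun _ => _) = fun x => \sum_(j <- enum Q) f j x); last first.
  by apply/funext => x; rewrite big_enum.
elim: (enum Q) => [|j s IH].
  by rewrite (_ : (fun _ => _) = cst 0)//; apply/funext => x; rewrite big_nil.
rewrite (_ : (fun _ => _) = (f j \+ (fun x => \sum_(i <- s) f i x))).
  by apply: measurable_funD; [exact: cf|exact: IH].
by apply/funext => x; rewrite big_cons.
Qed.

(** A zero exists exactly when rational points of the box make [g w] arbitrarily small: continuity
    gives one direction, the minimum attained on the box the other. This is a countable condition.
    Enlarging the box to [M + 1] leaves room for rational approximations of a zero. *)
Lemma measurable_compact_zero (n : nat) (g : T -> 'rV[R]_n -> R) (M : R) :
  0 <= M ->
  (forall w u, 0 <= g w u) ->
  (forall w u, g w u = 0 -> forall j, `|u ord0 j| <= M) ->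
  (forall u, measurable_fun setT (g ^~ u)) ->
  (forall w, continuous (g w)) ->
  measurable [set w | exists u, g w u = 0].
Proof.
move=> M0 g0 gM mg cg.
pose rv (c : {ffun 'I_n -> rat}) : 'rV[R]_n := \row_j ratr (c j).
pose C (N : nat) (c : {ffun 'I_n -> rat}) : set T :=
  if [forall j, `|ratr (c j)| <= M + 1 :> R] then [set w | g w (rv c) < N.+1%:R^-1]
  else set0.
have mC N c : measurable (C N c).
  rewrite /C; case: ifP => // _.
  rewrite (_ : [set _ | _] = (fun w => g w (rv c) < N.+1%:R^-1) @^-1` [set true])//.
  rewrite -[_ @^-1` _]setTI.
  have mf : measurable_fun setT (fun w => g w (rv c) < N.+1%:R^-1).
    by apply: measurable_fun_ltr.
  exact: mf.
pose box : set 'rV[R]_n := [set u | forall j, `[- (M + 1), M + 1]%classic (u ord0 j)].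
have boxc : compact box 
  by apply: (@rV_compact R n (fun=> `[- (M + 1), M + 1]%classic)) => j; exact: segment_compact.
have box0 : box !=set0.
  by exists 0 => j; rewrite /= mxE in_itv/=; apply/andP; split; lra.
have inv_gt0 N : 0 < N.+1%:R^-1 :> R by rewrite invr_gt0 ltr0n.
rewrite (_ : [set _ | _] = \bigcap_N \bigcup_c C N c); last first.
  apply/seteqP; split=> w /=.
    move=> [u gu0] N _; have uM := gM _ _ gu0.
    have /nbhs_ballP[e /= e0 ue] : \forall v \near u, `|g w u - g w v| < N.+1%:R^-1.
      exact: (cvgrPdist_lt _ _).1 (cg w u) _ (inv_gt0 N).
    pose e' := Num.min e 1.
    have e'0 : 0 < e' by rewrite lt_min e0 ltr01.
    have /boolp.choice[c cP] : forall j, exists q : rat,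
        ratr q \in `]u ord0 j - e', u ord0 j + e'[.
      move=> j; have [|q qP] := @rat_in_itvoo R (u ord0 j - e') (u ord0 j + e'); first lra.
      by exists q.
    have cd j : `|u ord0 j - ratr (c j)| < e'.
      by have := cP j; rewrite in_itv/= distrC ltr_distl.
    exists [ffun j => c j] => //; rewrite /C ifT; last first.
      apply/forallP => j; rewrite ffunE.
      have := uM j; have := cd j; rewrite /e' lt_min => /andP[_ h1 h2].
      have := ler_distD (u ord0 j) (ratr (c j)) 0; rewrite !subr0 distrC; lra.
    have : ball u e (rv [ffun j => c j]).
      split=> // i j; rewrite ord1 !mxE ffunE.
      by have := cd j; rewrite /e' lt_min => /andP[+ _].
    by move=> /ue /=; rewrite gu0 sub0r normrN ger0_norm.
  move=> h.
  have [u uC uP] := EVT_min_rV box0 boxc (continuous_subspaceT (cg w)).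
  exists u; apply/eqP; rewrite eq_le g0 andbT leNgt; apply/negP => gu.
  have [N Nu] : exists N : nat, N.+1%:R^-1 < g w u.
    by have [N _ /(_ N (leqnn N))] := near_infty_natSinv_lt (PosNum gu); exists N.
  have [c _] := h N I; rewrite /C; case: ifP => // /forallP cM /= gc.
  have : g w u <= g w (rv c).
    apply: uP; rewrite inE => j; rewrite /= in_itv/= mxE -ler_norml; exact: cM.
  by move=> /le_lt_trans /(_ gc) /(lt_trans Nu); rewrite ltxx.
apply: bigcap_measurable => [|N _]; first by exists 0%N.
by apply: countable_bigcupT_measurable.
Qed.

End feasibility.

(** * Normalization of sparse vectors and equality of sign patterns *)

Section sparse.
Context {R : realType}.
Implicit Types r : R.

Lemma in_supp {n : nat} (x : 'cV[R]_n) j : (j \in supp x) = (x j ord0 != 0).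
Proof. by rewrite inE. Qed.

Lemma sparse_vecs_bounded (n k : nat) r (x : 'cV[R]_n) :
  (0 < #|supp x| <= k)%N -> (forall j, j \in supp x -> 1 <= `|x j ord0| <= r) ->
  sparse_vecs k r x.
Proof.
move=> /andP[x0 xk] xb; have /card_gt0P[j jx] := x0.
have r1 : 1 <= r by have /andP[] := xb j jx; exact: le_trans.
have M1 : 1 <= max_abs x.
  have /andP[h _] := xb j jx; apply: le_trans h _.
  exact: (le_bigmax_cond _ (fun i => `|x i ord0|)).
have Mr : max_abs x <= r.
  by apply: bigmax_le => [|i ix]; [lra|have /andP[] := xb i ix].
have m1 : 1 <= min_abs x.
  by apply: le_bigmin => // i ix; have /andP[] := xb i ix.
split => //.
  by apply/eqP => xE; move: jx; rewrite in_supp xE mxE eqxx.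
rewrite ler_pdivrMr; last lra.
by nra.
Qed.

(** Dividing by the smallest absolute entry on the support puts the moduli there in [[1, r]], and so
    brings the vector into a compact set. *)
Lemma sparse_vecs_scale (n k : nat) r (x : 'cV[R]_n) : sparse_vecs k r x ->
  exists2 mu : R, 0 < mu &
    forall j, j \in supp x -> mu <= `|x j ord0| <= r * mu.
Proof.
move=> [x0 xk xr].
have [j jx] : exists j, j \in supp x.
  apply/existsP; apply: contraNT x0; rewrite negb_exists => /forallP h.
  apply/eqP/matrixP => i i'; rewrite ord1 mxE.
  by have := h i; rewrite in_supp negbK => /eqP.
have pos i : i \in supp x -> 0 < `|x i ord0| by rewrite in_supp normr_gt0.
have leM i : i \in supp x -> `|x i ord0| <= max_abs x.
  by move=> ix; exact: (le_bigmax_cond _ (fun i => `|x i ord0|)).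
have m0 : 0 < min_abs x.
  by apply: lt_bigmin => //; apply: lt_le_trans (pos j jx) (leM j jx).
exists (min_abs x) => // i ix; apply/andP; split.
  exact: (bigmin_le_cond _ (fun i => `|x i ord0|)).
by apply: le_trans (leM i ix) _; rewrite -ler_pdivrMr.
Qed.

Lemma sign_vecP (m : nat) (y z : 'cV[R]_m) :
  sign_vec y = sign_vec z <-> forall i, (0 <= y i ord0) = (0 <= z i ord0).
Proof.
split=> [yz i|yz]; last first.
  by apply/matrixP => i j; rewrite ord1 !mxE /sign1 yz.
have /matrixP/(_ i ord0) := yz; rewrite !mxE /sign1.
by case: ifP; case: ifP => // _ _; lra.
Qed.

End sparse.

(** * Measurability of the event that recovery fails *)

Section recovery_measurable.
Context {R : realType} {d : measure_display} {T : measurableType d}.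
Variables (P : probability T R) (m n k : nat) (r : R).
Variable a : 'I_m * 'I_n -> {RV P >-> R}.

Definition feasible (S : {set 'I_n}) (s : {ffun 'I_m -> bool}) : set T :=
  [set w | exists x : 'cV[R]_n, [/\ sparse_vecs k r x, supp x = S &
    forall i, (0 <= (random_matrix a w *m x) i ord0) = s i]].

(** Twice the positive part: a continuous penalty for the constraint [x <= 0]. *)
Definition twice_pos (x : R) := x + `|x|.

Lemma twice_pos_ge0 x : 0 <= twice_pos x.
Proof. by have := ler_norm (- x); rewrite normrN /twice_pos; lra. Qed.

Lemma twice_pos_eq0 x : (twice_pos x == 0) = (x <= 0).
Proof.
rewrite /twice_pos; have [x0|x0] := leP x 0; first by rewrite ler0_norm// subrr eqxx.
by rewrite gtr0_norm// gt_eqF// addr_gt0.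
Qed.

Definition rowdot (i : 'I_m) (w : T) (u : 'rV[R]_n) := \sum_(j < n) a (i, j) w * u ord0 j.

Definition entry_defect (S : {set 'I_n}) (j : 'I_n) (u : 'rV[R]_n) : R :=
  if j \in S then twice_pos (1 - `|u ord0 j|) + twice_pos (`|u ord0 j| - r)
  else `|u ord0 j|.

Definition sign_defect (s : {ffun 'I_m -> bool}) (q : nat) i w u : R :=
  if s i then twice_pos (- rowdot i w u) else twice_pos (rowdot i w u + q.+1%:R^-1).

(* Strict inequalities are relaxed to [<= - 1 / (q + 1)] so that the feasible set
   is closed; it is the union over [q] of the zero sets of the defect. *)
Definition defect S s q w (u : 'rV[R]_n) : R :=
  \sum_(j < n) entry_defect S j u + \sum_(i < m) sign_defect s q i w u.

Lemma entry_defect_ge0 S j u : 0 <= entry_defect S j u.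
Proof.
rewrite /entry_defect; case: ifP => _; last exact: normr_ge0.
by apply: addr_ge0; exact: twice_pos_ge0.
Qed.

Lemma sign_defect_ge0 s q i w u : 0 <= sign_defect s q i w u.
Proof. by rewrite /sign_defect; case: ifP; rewrite twice_pos_ge0. Qed.

Lemma defect_eq0 S s q w u : defect S s q w u = 0 <->
  (forall j, if j \in S then 1 <= `|u ord0 j| <= r else u ord0 j == 0) /\
  (forall i, if s i then 0 <= rowdot i w u else rowdot i w u <= - q.+1%:R^-1).
Proof.
have eE j : (entry_defect S j u == 0) =
    (if j \in S then 1 <= `|u ord0 j| <= r else u ord0 j == 0).
  rewrite /entry_defect; case: ifP => _; last by rewrite normr_eq0.
  by rewrite paddr_eq0 ?twice_pos_ge0// !twice_pos_eq0 !subr_le0.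
have sE i : (sign_defect s q i w u == 0) =
    (if s i then 0 <= rowdot i w u else rowdot i w u <= - q.+1%:R^-1).
  rewrite /sign_defect; case: ifP => _; rewrite twice_pos_eq0 ?oppr_le0//.
  by rewrite -lerBrDr sub0r.
have -> : (defect S s q w u = 0) <-> (\sum_(j < n) entry_defect S j u == 0) &&
    (\sum_(i < m) sign_defect s q i w u == 0).
  rewrite /defect -paddr_eq0; first by split=> [->|/eqP//].
    by apply: sumr_ge0 => j _; exact: entry_defect_ge0.
  by apply: sumr_ge0 => i _; exact: sign_defect_ge0.
rewrite !psumr_eq0; last 2 first.
- by move=> i _; exact: sign_defect_ge0.
- by move=> j _; exact: entry_defect_ge0.
split=> [/andP[/allP h1 /allP h2]|[h1 h2]].
  by split=> [j|i]; rewrite -?eE -?sE; [apply: h1|apply: h2]; rewrite mem_index_enum.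
by apply/andP; split; apply/allP => i _ /=; rewrite ?eE ?sE.
Qed.

Lemma continuous_twice_pos (U : topologicalType) (f : U -> R) : continuous f ->
  continuous (fun x => twice_pos (f x)).
Proof.
by move=> cf x; apply: cvgD; [exact: cf|apply: cvg_norm; exact: cf].
Qed.

Lemma continuous_rowdot i w : continuous (rowdot i w).
Proof.
apply: continuous_bigsum => j u.
pose c : R := a (i, j) w.
have c1 : continuous (fun _ : 'rV[R]_n => c) by exact: cst_continuous.
exact: cvgM (c1 u) (@coord_continuous _ 1 n ord0 j u).
Qed.

Lemma continuous_defect S s q w : continuous (defect S s q w).
Proof.
have cn j : continuous (fun u : 'rV[R]_n => `|u ord0 j|).
  by move=> u; exact: (cvg_norm (@coord_continuous R 1 n ord0 j u)).
have cc (c : R) : continuous (fun _ : 'rV[R]_n => c) by exact: cst_continuous.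
have ce : continuous (fun u : 'rV[R]_n => \sum_(j < n) entry_defect S j u).
  apply: continuous_bigsum => j.
  have -> : entry_defect S j = if j \in S then
      fun u => twice_pos (1 - `|u ord0 j|) + twice_pos (`|u ord0 j| - r)
    else fun u => `|u ord0 j|.
    by apply/funext => u; rewrite /entry_defect; case: ifP.
  case: ifP => _; last exact: cn.
  have c1 : continuous (fun u : 'rV[R]_n => twice_pos (1 - `|u ord0 j|)).
    by apply: continuous_twice_pos => u; exact: cvgB (cc _ u) (cn j u).
  have c2 : continuous (fun u : 'rV[R]_n => twice_pos (`|u ord0 j| - r)).
    by apply: continuous_twice_pos => u; exact: cvgB (cn j u) (cc _ u).
  by move=> u; exact: cvgD (c1 u) (c2 u).
have cs : continuous (fun u : 'rV[R]_n => \sum_(i < m) sign_defect s q i w u).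
  apply: continuous_bigsum => i.
  have -> : sign_defect s q i w = if s i then fun u => twice_pos (- rowdot i w u)
    else fun u => twice_pos (rowdot i w u + q.+1%:R^-1).
    by apply/funext => u; rewrite /sign_defect; case: ifP.
  case: ifP => _.
    by apply: continuous_twice_pos => u; exact: cvgN (@continuous_rowdot i w u).
  by apply: continuous_twice_pos => u;
    exact: cvgD (@continuous_rowdot i w u) (cc _ u).
by move=> u; exact: cvgD (ce u) (cs u).
Qed.

Lemma measurable_rowdot i u : measurable_fun setT (fun w => rowdot i w u).
Proof.
by apply: measurable_bigsum => j; apply: measurable_funM.
Qed.

Lemma measurable_defect S s q u : measurable_fun setT (fun w => defect S s q w u).
Proof.
apply: measurable_funD => //; apply: measurable_bigsum => i.
have mt (f : T -> R) : measurable_fun setT f -> measurable_fun setT (fun w => twice_pos (f w)).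
  by move=> mf; apply: measurable_funD => //; exact: measurableT_comp.
have -> : (fun w => sign_defect s q i w u) = if s i then
    fun w => twice_pos (- rowdot i w u)
  else fun w => twice_pos (rowdot i w u + q.+1%:R^-1).
  by apply/funext => w; rewrite /sign_defect; case: ifP.
case: ifP => _; apply: mt.
  by apply: measurable_funN; exact: measurable_rowdot.
by apply: measurable_funD => //; exact: measurable_rowdot.
Qed.

Lemma rowdotE i w (u : 'rV[R]_n) : (random_matrix a w *m u^T) i ord0 = rowdot i w u.
Proof. by rewrite mxE; apply: eq_bigr => j _; rewrite !mxE. Qed.

Lemma feasibleE S s : feasible S s =
  if (0 < #|S| <= k)%N then \bigcup_q [set w | exists u, defect S s q w u = 0] else set0.
Proof.
apply/seteqP; split=> w.
  move=> [x [xs xS xsgn]].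
  have [mu mu0 xmu] := sparse_vecs_scale xs.
  have [x0 xk _] := xs.
  have -> : (0 < #|S| <= k)%N.
    rewrite -xS xk andbT lt0n; apply: contraNN x0; rewrite finset.cards_eq0 => /eqP x0.
    apply/eqP/matrixP => i j; rewrite ord1 mxE; apply/eqP.
    by have : i \notin supp x; [rewrite x0 inE|rewrite in_supp negbK].
  (* Positive scaling keeps the support and all signs. *)
  pose u : 'rV[R]_n := (mu^-1 *: x)^T.
  have rowu i : rowdot i w u = mu^-1 * (random_matrix a w *m x) i ord0.
    by rewrite -rowdotE trmxK -scalemxAr mxE.
  have muV0 : 0 < mu^-1 by rewrite invr_gt0.
  (* Only finitely many rows are strictly negative, so one margin serves them all. *)
  have [q qP] : exists q : nat, forall i, ~~ s i -> rowdot i w u <= - q.+1%:R^-1.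
    have neg i : ~~ s i -> 0 < - rowdot i w u.
      rewrite -xsgn -ltNge rowu => y0.
      by rewrite oppr_gt0 pmulr_rlt0.
    have [q] : exists q : nat, forall i, i \in enum 'I_m -> ~~ s i -> rowdot i w u <= - q.+1%:R^-1.
      elim: (enum 'I_m) => [|i l [q IH]]; first by exists 0%N.
      have [si|si] := boolP (s i).
        by exists q => i'; rewrite inE => /orP[/eqP -> /negP//|/IH].
      have [N _ /(_ N (leqnn N)) /= hN] := near_infty_natSinv_lt (PosNum (neg i si)).
      exists (maxn q N) => i'; rewrite inE => /orP[/eqP -> _|il si'].
        rewrite lerNr; apply: le_trans (ltW hN).
        by rewrite lef_pV2 ?posrE ?ltr0n// ler_nat ltnS leq_maxr.
      apply: le_trans (IH _ il si') _; rewrite lerN2.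
      by rewrite lef_pV2 ?posrE ?ltr0n// ler_nat ltnS leq_maxl.
    by move=> h; exists q => i; apply: h; rewrite mem_enum.
  exists q => //; exists u; apply/defect_eq0; split=> [j|i].
    rewrite !mxE; case: ifP => jS; last first.
      by move: jS; rewrite -xS in_supp => /negbFE/eqP ->; rewrite mulr0.
    rewrite -xS in jS; have /andP[h1 h2] := xmu j jS.
    rewrite normrM gtr0_norm//; apply/andP; split.
      by rewrite mulrC ler_pdivlMr// mul1r.
    by rewrite mulrC ler_pdivrMr.
  case: ifP => si; last by apply: qP; rewrite si.
  by rewrite rowu pmulr_rge0// xsgn.
case: ifP => // Sk [q _ [u /defect_eq0[uS us]]].
have uE : supp u^T = S.
  apply/setP => j; rewrite in_supp mxE; have := uS j.
  case: ifP => [_ /andP[h _]|_ ->//].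
  by rewrite -normr_gt0; apply: lt_le_trans h.
exists u^T; split => //.
  apply: sparse_vecs_bounded; rewrite uE// => j jS.
  by have := uS j; rewrite jS mxE.
move=> i; rewrite rowdotE; have := us i; case: ifP => // _ h.
apply/negbTE; rewrite -ltNge; apply: le_lt_trans h _.
by rewrite oppr_lt0 invr_gt0 ltr0n.
Qed.

Lemma measurable_feasible S s : 1 <= r -> measurable (feasible S s).
Proof.
move=> r1; rewrite feasibleE; case: ifP => // _; apply: bigcup_measurable => q _.
apply: (@measurable_compact_zero _ _ _ _ _ r).
- by lra.
- move=> w u; apply: addr_ge0; apply: sumr_ge0 => ? _.
    exact: entry_defect_ge0.
  exact: sign_defect_ge0.
- move=> w u /defect_eq0[h _] j; have := h j.
  by case: ifP => [_ /andP[]|_ /eqP ->] //; rewrite normr0; lra.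
- exact: measurable_defect.
- exact: continuous_defect.
Qed.

Lemma measurable_not_recovery : 1 <= r ->
  measurable [set w | ~ universal_support_recovery k r (random_matrix a w)].
Proof.
move=> r1.
(* Failure means that two distinct supports are feasible with the same sign pattern, and there are
   finitely many such triples. *)
rewrite (_ : [set _ | _] = \bigcup_(z in [set: ({set 'I_n} * {set 'I_n} * {ffun 'I_m -> bool})%type])
    (if z.1.1 == z.1.2 then set0 else feasible z.1.1 z.2 `&` feasible z.1.2 z.2)).
  apply: fin_bigcup_measurable => // z _; case: ifP => // _.
  by apply: measurableI; exact: measurable_feasible.
apply/seteqP; split=> w /=.
  move=> /existsNP[x /existsNP[y /not_implyP[xs /not_implyP[ys /not_implyP[xy]]]]].
  move=> /contrapT /sign_vecP sxy.
  exists (supp x, supp y, [ffun i => 0 <= (random_matrix a w *m x) i ord0]) => //=.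
  case: eqP => // _; split; [exists x|exists y]; split => // i; rewrite ffunE//.
move=> [[[S S'] s] _ /=]; case: eqP => // SS' [[x [xs xS xsgn]] [y [ys yS ysgn]]].
apply/existsNP; exists x; apply/existsNP; exists y.
apply/not_implyP; split => //; apply/not_implyP; split => //.
apply/not_implyP; split; first by rewrite xS yS.
by apply; apply/sign_vecP => i; rewrite xsgn ysgn.
Qed.

End recovery_measurable.

(** * Numerical bound on the second moment *)

Section numeric.
Context {R : realType}.

Lemma expR_le_Vsub (x : R) : x < 1 -> expR x <= (1 - x)^-1.
Proof.
move=> x1; rewrite -[expR x]invrK -expRN lef_pV2 ?posrE ?expR_gt0 ?subr_gt0//.
exact: expR_ge1Dx.
Qed.

(** Read [h = sqrt k], [s = sqrt (ln k)], [y = k ^ (2 eps)]. Then [b] is at most of order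
    [s / (r h)], [4 m b] of order [c K s^2] and [A] of order [c s^3 / h]. Small overlaps contribute
    [5 / 4], large ones [1 / 4]. *)
Lemma separation_parameters (m K B : nat) (h s y r c eps : R) :
  let t := 4 * s / r in
  let b := 2 * t * normal_peak (Num.sqrt K%:R) in
  let A := 4 * m%:R * b ^+ 2 / K%:R in
  (0 < K)%N -> 0 < eps -> 1 <= r -> 1 <= s -> 1 <= y -> 0 < h -> 0 < c ->
  h ^+ 2 / 2 <= K%:R -> K%:R <= h ^+ 2 ->
  m%:R <= c * r * h ^+ 3 * s -> 16 * s <= h -> h * y / 2 <= B%:R ->
  s ^+ 5 <= 216 * h -> s ^+ 3 <= y / eps ^+ 2 ->
  64 * (64 * (216 * c)) <= 1 / 10 -> 64 * (64 * (c / eps ^+ 2)) <= 1 / 10 ->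
  h = expR (s ^+ 2 / 8) ^+ 4 -> 128 <= expR (s ^+ 2 / 8) ^+ 2 ->
  b <= 1 / 2 /\
  expR (A * (t ^+ 2 / 2)) * (expR A + B.-1%:R) ^+ K +
    expR (4 * m%:R * b) * (Num.sqrt B%:R)^-1 ^+ K * (B%:R + B.-1%:R) ^+ K
    <= 3 / 2 * B%:R ^+ K.
Proof.
move=> t b A K0 eps0 r1 s1 y1 h0 c0.
have KR : 0 < K%:R :> R by rewrite ltr0n.
have r0 : 0 < r by exact: lt_le_trans r1.
have s0 : 0 < s by exact: lt_le_trans s1.
have y0 : 0 < y by exact: lt_le_trans y1.
have [r0' s0' h0'] : [/\ 0 <= r, 0 <= s & 0 <= h] by split; exact: ltW.
have c0' : 0 <= c by exact: ltW.
have m0 : 0 <= m%:R :> R by rewrite ler0n.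
have t0 : 0 <= t by rewrite divr_ge0 ?mulr_ge0.
have t4 : t <= 4 * s by rewrite ler_pdivrMr// ler_peMr// mulr_ge0.
pose X := s / (r * h).
have rh0 : 0 < r * h by rewrite mulr_gt0.
have X0 : 0 <= X by rewrite divr_ge0// mulr_ge0.
have Xs : X <= s / h by rewrite ler_wpM2l// lef_pV2 ?posrE// ler_peMl.
have b0 : 0 <= b.
  by apply: mulr_ge0; [apply: mulr_ge0|exact: normal_peak_ge0].
move=> Kl Ku mu.
(* From [K >= h^2 / 2] and [pi >= 2] follows [sqrt (2 pi K) >= h]. *)
have bX : b <= 8 * X.
  have -> : 8 * X = 2 * t * h^-1.
    by rewrite /X /t; field; rewrite !gt_eqF.
  rewrite /b /normal_peak; apply: ler_wpM2l; first by rewrite mulr_ge0.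
  rewrite lef_pV2 ?posrE//; last first.
    by rewrite sqrtr_gt0 sqr_sqrtr ?ler0n// pmulrn_lgt0// mulr_gt0 ?pi_gt0.
  rewrite -[leLHS]ger0_norm// -sqrtr_sqr ler_wsqrtr// sqr_sqrtr ?ler0n//.
  have := ler_wpM2l (ltW KR) (@pi_ge2 R).
  by have := sqr_ge0 h; rewrite -mulr_natr; move: Kl; clear; lra.
clearbody b.
have mX : m%:R * X <= c * h ^+ 2 * s ^+ 2.
  apply: le_trans (ler_wpM2r X0 mu) _; rewrite le_eqVlt; apply/orP; left; apply/eqP.
  by rewrite /X; field; rewrite !gt_eqF.
pose D := 4 * m%:R * b.
have D0 : 0 <= D by rewrite !mulr_ge0.
have DX : D <= 32 * (c * h ^+ 2 * s ^+ 2).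
  have := ler_wpM2l m0 bX; rewrite /D; move: mX; clear; lra.
have KV : K%:R^-1 <= 2 / h ^+ 2.
  rewrite -[2 / _]invf_div lef_pV2 ?posrE// divr_gt0// exprn_gt0//.
have AD : A = D * b / K%:R by rewrite /A /D expr2 mulrA.
have A0 : 0 <= A by rewrite AD divr_ge0 ?mulr_ge0.
have bXs : b <= 8 * (s / h) by apply: le_trans bX _; rewrite ler_wpM2l.
have AX : A <= 512 * c * (s ^+ 3 / h).
  have h1' : D * b <= 32 * (c * h ^+ 2 * s ^+ 2) * (8 * (s / h)) by exact: ler_pM.
  rewrite AD; apply: le_trans (ler_pM _ _ h1' KV) _.
  - by rewrite mulr_ge0.
  - by rewrite invr_ge0 ltW.
  - rewrite le_eqVlt; apply/orP; left; apply/eqP; field; by rewrite gt_eqF.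
have DE : D = 4 * m%:R * b by [].
clearbody D; clearbody A; clearbody X.
move=> sh Bl s5 s3 c216 ceps.
have At : A * (t ^+ 2 / 2) <= 1 / 10.
  have t2 : t ^+ 2 / 2 <= 8 * s ^+ 2.
    have : t ^+ 2 <= (4 * s) ^+ 2 by rewrite lerXn2r ?nnegrE// mulr_ge0.
    by clear; rewrite exprMn; lra.
  apply: le_trans (ler_pM A0 _ AX t2) _; first by rewrite divr_ge0 ?sqr_ge0.
  have -> : 512 * c * (s ^+ 3 / h) * (8 * s ^+ 2) = 64 * (64 * (s ^+ 5 / h * c)).
    by field; rewrite gt_eqF.
  apply: le_trans c216; rewrite !ler_wpM2l// ler_wpM2r//.
  by rewrite ler_pdivrMr.
have A12 : A <= 1 / 2.
  have s35 : s ^+ 3 / h <= 216.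
    rewrite ler_pdivrMr//; apply: le_trans s5.
    by rewrite ler_weXn2l.
  have := ler_wpM2l c0' s35; move: AX c216; clear; lra.
have hy16 : 16 <= h * y.
  have : 16 * 1 <= h * y.
    apply: ler_pM => //; move: sh s1; clear; lra.
  by rewrite mulr1.
have B1 : 1 <= B%:R :> R by move: hy16 Bl; clear; lra.
have B0 : 0 < B%:R :> R by exact: lt_le_trans B1.
have B0' : 0 <= B%:R :> R by exact: ltW.
have hy0 : 0 < h * y / 2 by rewrite divr_gt0 ?mulr_gt0.
have e20 : 0 < eps ^+ 2 by rewrite exprn_gt0.
(* Typical overlaps, about [K / B], cost an exponent of order [c s^3 / y]; here the surplus [y] in
   the block size pays for the logarithms. *)
have AB : K%:R * (2 * A / B%:R) <= 1 / 10.
  have BV : B%:R^-1 <= (h * y / 2)^-1 by rewrite lef_pV2.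
  have h1' : K%:R * A <= h ^+ 2 * (512 * c * (s ^+ 3 / h)).
    by apply: ler_pM => //; exact: ltW.
  have -> : K%:R * (2 * A / B%:R) = 2 * (K%:R * A * B%:R^-1) by ring.
  have h2' : K%:R * A * B%:R^-1 <= h ^+ 2 * (512 * c * (s ^+ 3 / h)) * (h * y / 2)^-1.
    by apply: ler_pM; rewrite ?invr_ge0 ?mulr_ge0// ltW.
  have e3 : h ^+ 2 * (512 * c * (s ^+ 3 / h)) * (h * y / 2)^-1 = 16 * (64 * (c * (s ^+ 3 / y))).
    by field; rewrite !gt_eqF.
  have s3y : s ^+ 3 / y <= (eps ^+ 2)^-1 by rewrite ler_pdivrMr// mulrC.
  have := ler_wpM2l c0' s3y; rewrite e3 in h2'; move: h2' ceps; clear; lra.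
move=> hz z128; split.
  apply: le_trans bXs _; have : s / h <= 1 / 16.
    by rewrite ler_pdivrMr//; move: sh; clear; lra.
  by clear; lra.
have BpE : B.-1%:R = B%:R - 1 :> R.
  by rewrite -subn1 natrB// -(ler_nat R).
have first : expR (A * (t ^+ 2 / 2)) * (expR A + B.-1%:R) ^+ K <= 5 / 4 * B%:R ^+ K.
  have eA : expR A <= 1 + 2 * A.
    apply: le_trans (expR_le_Vsub _) _; first by move: A12; clear; lra.
    have A1 : 0 < 1 - A by move: A12; clear; lra.
    by rewrite -div1r ler_pdivrMr//; move: A0 A12; clear; nra.
  have step : (expR A + B.-1%:R) ^+ K <= expR (K%:R * (2 * A / B%:R)) * B%:R ^+ K.
    rewrite expRM_natl -exprMn lerXn2r ?nnegrE ?addr_ge0 ?mulr_ge0 ?expR_ge0 ?ler0n//.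
    have h3 : expR A + B.-1%:R <= (1 + 2 * A / B%:R) * B%:R.
      rewrite BpE mulrDl mul1r divfK ?gt_eqF//; move: eA; clear; lra.
    by apply: le_trans h3 _; rewrite ler_wpM2r// expR_ge1Dx.
  apply: le_trans (ler_wpM2l (expR_ge0 _) step) _.
  rewrite [leLHS]mulrA -expRD ler_wpM2r ?exprn_ge0//.
  apply: (@le_trans _ _ (expR (1 / 5))); first by rewrite ler_expR; move: At AB; clear; lra.
  apply: le_trans (expR_le_Vsub _) _; first by clear; lra.
  by have -> : (1 - 1 / 5)^-1 = 5 / 4 :> R by field.
have second : expR D * (Num.sqrt B%:R)^-1 ^+ K * (B%:R + B.-1%:R) ^+ K <= 1 / 4 * B%:R ^+ K.
  (* This is [k ^ (1 / 8)]. The crude bound costs at most [z] per block, while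
     [B >= z^4 / 2 >= 64 z^2] gives [sqrt B >= 8 z]. As [B + (B - 1) <= 2 B], each block keeps at
     most a quarter of [B]. *)
  pose z := expR (s ^+ 2 / 8).
  have z0 : 0 < z by exact: expR_gt0.
  have z0' : 0 <= z by exact: ltW.
  have Dz : expR D <= z ^+ K.
    rewrite /z -expRM_natl ler_expR.
    apply: le_trans DX _.
    have Ks0 : 0 <= K%:R * s ^+ 2 by rewrite mulr_ge0 ?sqr_ge0 ?ler0n.
    have hK : h ^+ 2 * s ^+ 2 <= 2 * (K%:R * s ^+ 2).
      rewrite mulrA ler_wpM2r ?sqr_ge0//; move: Kl; clear; lra.
    have c1 : 512 * c <= 1 by move: c216 c0; clear; lra.
    have := ler_wpM2l c0' hK; have := ler_wpM2r Ks0 c1; clear; lra.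
  have sB0 : 0 < Num.sqrt B%:R :> R by rewrite sqrtr_gt0.
  have sB0' : 0 <= Num.sqrt B%:R :> R by exact: ltW.
  have sBz : 8 * z <= Num.sqrt B%:R.
    rewrite -[leLHS]ger0_norm ?mulr_ge0// -sqrtr_sqr ler_wsqrtr//.
    apply: le_trans Bl.
    have zz : 128 * z ^+ 2 <= z ^+ 4.
      by rewrite (exprD z 2 2) ler_wpM2r ?sqr_ge0.
    have := ler_wpM2l h0' y1; rewrite exprMn; move: zz; rewrite -/z in hz.
    by rewrite -hz; clear; lra.
  apply: (@le_trans _ _ ((1 / 4) ^+ K * B%:R ^+ K)); last first.
    rewrite ler_wpM2r ?exprn_ge0// -[leRHS]expr1 ler_wiXn2l//; clear; lra.
  apply: (@le_trans _ _ (z ^+ K * (Num.sqrt B%:R)^-1 ^+ K * (B%:R + B.-1%:R) ^+ K)).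
    by rewrite !ler_wpM2r ?exprn_ge0 ?invr_ge0 ?addr_ge0 ?ler0n.
  rewrite -!exprMn lerXn2r ?nnegrE ?mulr_ge0 ?invr_ge0 ?addr_ge0 ?ler0n//.
  have zB : z / Num.sqrt B%:R <= 1 / 8.
    by rewrite ler_pdivrMr//; move: sBz; clear; lra.
  have -> : 1 / 4 * B%:R = 1 / 8 * (2 * B%:R) :> R by clear; lra.
  apply: ler_pM => //; rewrite ?divr_ge0 ?addr_ge0 ?ler0n//.
  by rewrite BpE; move: B0; clear; lra.
by rewrite -DE; move: first second; clear; lra.
Qed.

End numeric.

(** * Translating the hypotheses on [n], [k], [m] and [r] into polynomial inequalities *)

Section regime.
Context {R : realType}.

Lemma parameter_regime (n k m : nat) (r eps c : R) :
  let L : R := ln k%:R in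
  let s := Num.sqrt L in
  let h := expR (L / 2) in
  let y := expR (2 * eps * L) in
  0 < eps -> eps < 2 / 3 -> 0 < c -> c * (16 * expR 512) <= 1 ->
  (0 < n)%N -> (2 <= k)%N -> (0 < m)%N -> 1 <= r ->
  (k%:R : R) <= n%:R `^ (2 / 3 - eps) ->
  r <= k%:R `^ (1 / 2 - eps) ->
  (m%:R : R) < c * r * (k%:R / L) `^ (3 / 2) * Num.min (r ^+ 2) (L ^+ 2) ->
  [/\ 1 <= s, 1 <= y, h ^+ 2 / 2 <= k.-1%:R & k.-1%:R <= h ^+ 2] /\
  [/\ m%:R <= c * r * h ^+ 3 * s, 16 * s <= h,
      h * y / 2 <= (n.-1 %/ k.-1)%:R, s ^+ 5 <= 216 * h & s ^+ 3 <= y / eps ^+ 2] /\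
  [/\ h = expR (s ^+ 2 / 8) ^+ 4, 128 <= expR (s ^+ 2 / 8) ^+ 2, r <= h & s ^+ 2 = L].
Proof.
move=> L s h y eps0 eps23 c0 c512 n0 k2 m0 r1 kn rk mlt.
have k0 : 0 < k%:R :> R by rewrite ltr0n; exact: leq_trans k2.
have kL : k%:R = expR L by rewrite /L lnK.
have L0 : 0 < L by rewrite ln_gt0// ltr1n.
have s0 : 0 < s by rewrite sqrtr_gt0.
have sL : s ^+ 2 = L by rewrite sqr_sqrtr// ltW.
have h0 : 0 < h by exact: expR_gt0.
have hk : h ^+ 2 = k%:R.
  by rewrite kL -expRM_natl; congr expR; field.
have kR2 : 2 <= k%:R :> R by rewrite ler_nat.
have KE : k.-1%:R = k%:R - 1 :> R.
  by rewrite -subn1 natrB//; exact: leq_trans k2.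
have Kl : h ^+ 2 / 2 <= k.-1%:R.
  by rewrite hk KE; move: kR2; clear; lra.
have Ku : k.-1%:R <= h ^+ 2 by rewrite hk KE; clear; lra.
have rh : r <= h.
  apply: le_trans rk _; rewrite /powR gt_eqF// ler_expR -/L mulrC ler_wpM2l ?(ltW L0)//.
  by move: eps0; clear; lra.
(* In terms of [h] and [s], [(k / L) ^ (3 / 2) * L^2 = h^3 s]. *)
have mu : m%:R < c * r * h ^+ 3 * s.
  apply: lt_le_trans mlt _.
  have -> : (k%:R / L) `^ (3 / 2) = (h / s) ^+ 3.
    have -> : k%:R / L = (h / s) `^ 2%:R.
      by rewrite powR_mulrn ?divr_ge0 ?(ltW h0) ?(ltW s0)// exprMn exprVn hk sL.
    rewrite -powRrM -powR_mulrn ?divr_ge0 ?(ltW h0) ?(ltW s0)//.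
    by congr (_ `^ _); field.
  have -> : c * r * h ^+ 3 * s = c * r * (h / s) ^+ 3 * L ^+ 2.
    by rewrite -sL; field; rewrite gt_eqF.
  apply: ler_wpM2l; last by rewrite ge_min lexx orbT.
  apply: mulr_ge0; last by rewrite exprn_ge0// divr_ge0 ?(ltW h0) ?(ltW s0).
  by apply: mulr_ge0; [exact: ltW|exact: le_trans r1].
(* Otherwise [s <= 16] and [r <= h <= expR 128], so [m < c * 16 * expR 512 <= 1], against
   [m >= 1]. *)
have L256 : 256 <= L.
  rewrite leNgt; apply/negP => Llt.
  have s16 : s <= 16.
    have : s <= Num.sqrt (16 ^+ 2).
      by rewrite ler_wsqrtr//; move: Llt; clear; lra.
    by rewrite sqrtr_sqr ger0_norm.
  have h128 : h <= expR 128 by rewrite ler_expR; move: Llt; clear; lra.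
  have m1 : 1 <= m%:R :> R by rewrite ler1n.
  have : c * r * h ^+ 3 * s <= c * (16 * expR 512).
    have -> : c * r * h ^+ 3 * s = c * (s * (r * h ^+ 3)) by ring.
    rewrite ler_wpM2l ?(ltW c0)//.
    have -> : expR 512 = expR 128 * expR 128 ^+ 3 :> R.
      by rewrite -expRM_natl -expRD; congr expR; ring.
    have r0 : 0 <= r by exact: le_trans r1.
    apply: ler_pM => //; rewrite ?mulr_ge0 ?exprn_ge0 ?(ltW s0) ?(ltW h0)//.
    apply: ler_pM; rewrite ?exprn_ge0 ?(ltW h0)//; first exact: le_trans h128.
    by rewrite lerXn2r ?nnegrE ?expR_ge0 ?(ltW h0).
  by move: m1 mu c512; clear; lra.
have sq_exp (x : R) : 0 <= x -> x ^+ 2 <= expR x ^+ 2.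
  by move=> x0; rewrite lerXn2r ?nnegrE ?expR_ge0//; have := expR_ge1Dx x; move: x0; clear; lra.
have s1 : 1 <= s by rewrite -[leLHS]sqrtr1 ler_wsqrtr//; move: L256; clear; lra.
have sh : 16 * s <= h.
  have e1 : h = expR (L / 4) ^+ 2 by rewrite -expRM_natl; congr expR; field.
  have := sq_exp (L / 4); rewrite -e1 => /(_ _).
  have ss : s <= L by rewrite -sL expr2 ler_peMr// ltW.
  move=> /(_ (divr_ge0 (ltW L0) (ler0n _ _))).
  have : 256 * L <= L * L by rewrite ler_wpM2r// ltW.
  by rewrite expr2; move: ss; clear; lra.
have y1 : 1 <= y.
  by rewrite -[leLHS]expR0 ler_expR !mulr_ge0 ?(ltW eps0) ?(ltW L0).
have hy2 : 2 <= h * y.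
  have : 16 * 1 <= h * y by apply: ler_pM => //; move: sh s1; clear; lra.
  by clear; lra.
have nl : h ^+ 3 * y <= n%:R.
  have nR : 0 < n%:R :> R by rewrite ltr0n.
  rewrite -[leRHS]lnK ?posrE// /h /y -expRM_natl -expRD ler_expR.
  have Ln : L <= (2 / 3 - eps) * ln n%:R.
    by move: kn; rewrite /powR gt_eqF// kL ler_expR.
  have a0 : 0 <= 3 / 2 + 2 * eps by move: eps0; clear; lra.
  have ln0 : 0 <= ln n%:R :> R by rewrite ln_ge0// ler1n.
  have := ler_wpM2l a0 Ln.
  have : (3 / 2 + 2 * eps) * ((2 / 3 - eps) * ln n%:R) <= ln n%:R.
    rewrite mulrA ler_piMl//.
    by have := sqr_ge0 eps; move: eps0; clear; lra.
  by clear; lra.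
(* Rounding down costs at most one: [h y <= B + 1], and [h y >= 2] turns this into a factor 2. *)
have Bl : h * y / 2 <= (n.-1 %/ k.-1)%:R.
  have K0 : (0 < k.-1)%N by case: (k) k2 => [|[]].
  have nB : (n <= (n.-1 %/ k.-1).+1 * k.-1)%N.
    by rewrite -[leqLHS](prednK n0) ltn_ceil.
  set B := (n.-1 %/ k.-1)%N in nB *.
  have nBR : h ^+ 3 * y <= (B%:R + 1) * h ^+ 2.
    apply: le_trans nl _; apply: (@le_trans _ _ (B.+1 * k.-1)%:R); first by rewrite ler_nat.
    by rewrite natrM -natr1 ler_wpM2l// addr_ge0.
  have : h * y <= B%:R + 1.
    have h20 : 0 < h ^+ 2 by rewrite exprn_gt0.
    rewrite -(ler_pM2r h20); apply: le_trans nBR; rewrite le_eqVlt.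
    by apply/orP; left; apply/eqP; ring.
  by move: hy2; clear; lra.
(* [s^6 = L^3 = 216 (L / 6)^3], and [L / 6 <= expR (L / 6)], whose cube is [h]. *)
have s5 : s ^+ 5 <= 216 * h.
  have e1 : h = expR (L / 6) ^+ 3 by rewrite -expRM_natl; congr expR; field.
  apply: (@le_trans _ _ (s ^+ 6)); first by rewrite ler_weXn2l.
  rewrite (exprM s 2 3) sL e1.
  have : (L / 6) ^+ 3 <= expR (L / 6) ^+ 3.
    rewrite lerXn2r ?nnegrE ?expR_ge0 ?divr_ge0 ?(ltW L0)//.
    by have := expR_ge1Dx (L / 6); clear; lra.
  by rewrite exprMn; clear; lra.
(* [y = expR (eps L) ^ 2 >= (eps L)^2 = eps^2 s^4]; hence the dependence of [c] on [eps^2]. *)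
have s3 : s ^+ 3 <= y / eps ^+ 2.
  have e1 : y = expR (eps * L) ^+ 2 by rewrite -expRM_natl; congr expR; ring.
  apply: (@le_trans _ _ (s ^+ 4)); first by rewrite ler_weXn2l.
  rewrite (exprM s 2 2) sL ler_pdivlMr ?exprn_gt0// mulrC -exprMn e1.
  by apply: sq_exp; rewrite mulr_ge0 ?(ltW eps0) ?(ltW L0).
split; [|split]; split => //.
- exact: ltW.
- by rewrite sL -expRM_natl /h; congr expR; field.
- rewrite sL.
  have := expR_ge1Dx (L / 8) => e1.
  have : 33 <= expR (L / 8) by move: e1 L256; clear; lra.
  move=> e33; apply: (@le_trans _ _ (33 * 33)); first by clear; lra.
  by rewrite expr2; apply: ler_pM => //; clear; lra.
Qed.

End regime.

(** * Separated row sums produce two indistinguishable sparse vectors *)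

Section not_recovered.
Context {R : realType}.

Lemma sign1_perturb (x y : R) : `|y| < `|x| -> sign1 (x + y) = sign1 x.
Proof.
rewrite /sign1; have [x0|x0] := lerP 0 x.
  by rewrite (ger0_norm x0) ltr_norml => /andP[h _]; rewrite ifT//; move: h; clear; lra.
rewrite (ltr0_norm x0) ltr_norml => /andP[_ h]; rewrite ifF//; apply/negbTE.
by rewrite -ltNge; move: h; clear; lra.
Qed.

Lemma not_recovery_of_separated (m n k K B : nat) (r t : R) (A : 'M[R]_(m, n))
    (e : 'I_K * 'I_B -> 'I_n) (j0 : 'I_n) (s : {ffun 'I_K -> 'I_B}) :
  injective e -> (forall z, e z != j0) -> (0 < K < k)%N -> 1 <= r ->
  (forall i, t < `|\sum_(b < K) A i (e (b, s b))|) ->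
  (forall i, `|A i j0| <= r * t) ->
  ~ universal_support_recovery k r A.
Proof.
move=> inj_e ej0 /andP[K0 Kk] r1 large small.
have r0 : 0 < r by exact: lt_le_trans r1.
pose J := [set e (b, s b) | b : 'I_K]%SET.
have inj_s : injective (fun b => e (b, s b)) by move=> b b' /inj_e[].
have cJ : #|J| = K by rewrite card_imset// card_ord.
have j0J : j0 \notin J by apply/imsetP => -[b _ /eqP]; rewrite eq_sym (negbTE (ej0 _)).
pose u : 'cV[R]_n := \col_j (if j \in J then r else 0).
pose v : 'cV[R]_n := u + delta_mx j0 ord0.
have vE j : v j ord0 = if j == j0 then 1 else u j ord0.
  rewrite !mxE eqxx andbT; case: eqP => [->|_]; last by rewrite addr0.
  by rewrite (negbTE j0J) add0r.
have su : supp u = J.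
  by apply/setP => j; rewrite in_supp mxE; case: ifP => _; rewrite ?eqxx// gt_eqF.
have sv : supp v = j0 |: J.
  apply/setP => j; rewrite in_supp vE !inE; case: (j =P j0) => _ /=; first by rewrite oner_neq0.
  by rewrite -su in_supp.
have uJ j : j \in J -> u j ord0 = r by move=> jJ; rewrite mxE jJ.
apply/existsNP; exists u; apply/existsNP; exists v.
apply/not_implyP; split.
  apply: sparse_vecs_bounded; rewrite su ?cJ ?K0 ?(ltnW Kk)// => j jJ.
  by rewrite uJ// gtr0_norm// r1 lexx.
apply/not_implyP; split.
  apply: sparse_vecs_bounded; rewrite sv; first by rewrite finset.cardsU1 j0J cJ.
  move=> j; rewrite !inE vE; case: (j =P j0) => /= [_ _|_ jJ]; first by rewrite normr1 lexx.
  by rewrite uJ// gtr0_norm// r1 lexx.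
apply/not_implyP; split.
  by rewrite su sv => /setP/(_ j0); rewrite !inE eqxx (negbTE j0J).
apply; apply/matrixP => i z; rewrite ord1 !mxE.
have -> : \sum_j A i j * v j ord0 = \sum_j A i j * u j ord0 + A i j0.
  rewrite (bigD1 j0)//= [in RHS](bigD1 j0)//= vE eqxx mulr1.
  rewrite [u j0 ord0]mxE (negbTE j0J) mulr0 add0r addrC; congr (_ + _).
  by apply: eq_bigr => j jj0; rewrite vE (negbTE jj0).
rewrite sign1_perturb//.
have -> : \sum_j A i j * u j ord0 = r * \sum_(b < K) A i (e (b, s b)).
  rewrite mulr_sumr -(big_imset (fun j => r * A i j))/=; last by move=> ? ? _ _; exact: inj_s.
  rewrite [RHS]big_mkcond/=; apply: eq_bigr => j _; rewrite mxE.
  rewrite (_ : (j \in _) = (j \in J))//; case: ifP => _; last by rewrite mulr0.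
  by rewrite mulrC.
rewrite normrM (gtr0_norm r0); apply: le_lt_trans (small i) _.
by rewrite ltr_pM2l.
Qed.

End not_recovered.

(** * Union bound and final count of probabilities *)

Lemma union_bound {R : realType} {d : measure_display} {T : measurableType d}
    (P : probability T R) (I : finType) (F : I -> set T) :
  (forall i, measurable (F i)) ->
  (P (\bigcup_(i in setT) F i) <= \sum_i P (F i))%E.
Proof.
move=> mF.
have -> : \bigcup_(i in setT) F i = \bigcup_(i in [set` index_enum I]) F i.
  by apply/seteqP; split=> w [i _ Fi]; exists i => //=; rewrite mem_index_enum.
elim: (index_enum I) => [|i l IH].
  by rewrite set_nil bigcup_set0 measure0 big_nil.
have -> : \bigcup_(j in [set` i :: l]) F j = F i `|` \bigcup_(j in [set` l]) F j.
  apply/seteqP; split=> w.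
    by case=> j; rewrite /= inE => /orP[/eqP ->|jl] Fj; [left|right; exists j].
  by case=> [Fi|[j jl Fj]]; [exists i|exists j] => //=; rewrite inE ?eqxx// jl orbT.
rewrite big_cons; apply: le_trans (measureU2 _ _ _) (leeD2l _ IH) => //.
by apply: fin_bigcup_measurable => // j _; exact: mF.
Qed.

Theorem theorem2 (R : realType) (eps : R) (eps_gt0 : 0 < eps)
    (eps_lt : eps < 2 / 3) :
  exists2 c : R, 0 < c &
    forall (n k m : nat) (r : R),
      (0 < n)%N -> (2 <= k)%N -> (0 < m)%N -> 1 <= r ->
      (k%:R : R) <= n%:R `^ (2 / 3 - eps) ->
      r <= Num.min (n%:R `^ (eps / 2)) (k%:R `^ (1 / 2 - eps)) ->
      (m%:R : R) < c * r * (k%:R / ln k%:R) `^ (3 / 2)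
                   * Num.min (r ^+ 2) (ln k%:R ^+ 2) ->
      forall (d : measure_display) (T : measurableType d)
        (P : probability T R) (a : 'I_m * 'I_n -> {RV P >-> R}),
        iid_standard_gaussian a ->
        ((1 / 3)%:E <=
          P [set w | ~ universal_support_recovery k r (random_matrix a w)])%E.
Proof.
(* The first factor is below both 1 and [eps^2], the second forces [ln k >= 256], and the third
   covers the numerical constants, the largest being [64 * 64 * 216 * 10]. *)
pose c : R := eps ^+ 2 / (1 + eps ^+ 2) * (expR 512)^-1 * (100 ^+ 4)^-1.
have e2 : 0 < eps ^+ 2 by rewrite exprn_gt0.
have E0 : 0 < expR 512 :> R by exact: expR_gt0.
have E1 : 1 <= expR 512 :> R by apply: ltW; rewrite expR_gt1 ltr0n.
have h100 : 0 < 100 ^+ 4 :> R by rewrite exprn_gt0.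
have e21 : 0 < 1 + eps ^+ 2 by rewrite addr_gt0.
have c0 : 0 < c by rewrite !mulr_gt0 ?invr_gt0.
have cle : c <= eps ^+ 2 * (100 ^+ 4)^-1.
  rewrite ler_wpM2r ?invr_ge0 ?(ltW h100)// ler_pdivrMr// ler_pdivrMr//.
  by rewrite -mulrA ler_peMr ?(ltW e2)// mulr_ege1// lerDl ltW.
have q1 : eps ^+ 2 / (1 + eps ^+ 2) <= 1 by rewrite ler_pdivrMr// mul1r lerDr.
have cE : c * expR 512 <= (100 ^+ 4)^-1.
  have -> : c * expR 512 = eps ^+ 2 / (1 + eps ^+ 2) * (100 ^+ 4)^-1.
    by rewrite /c; field; rewrite !gt_eqF.
  by rewrite ler_piMl// invr_ge0 ltW.
have c1 : c <= (100 ^+ 4)^-1.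
  by apply: le_trans cE; rewrite ler_peMr// ltW.
have h4 : 64 * (64 * (216 * (100 ^+ 4)^-1)) <= 1 / 10 :> R.
  by rewrite !mulrA ler_pdivrMr//; clear; lra.
have i0 : 0 <= (100 ^+ 4)^-1 :> R by rewrite invr_ge0 ltW.
have c512 : c * (16 * expR 512) <= 1 by move: cE h4 i0; clear; lra.
have c_le1 : c <= 1 by move: c1 h4 i0; clear; lra.
clearbody c; clear E0 E1 cE.
exists c => // n k m r n0 k2 m0 r1 kn + mlt d T P a iid.
rewrite le_min => /andP[_ rk].
have c216 : 64 * (64 * (216 * c)) <= 1 / 10 by move: c1 h4; clear; lra.
have ceps : 64 * (64 * (c / eps ^+ 2)) <= 1 / 10.
  have : c / eps ^+ 2 <= (100 ^+ 4)^-1 by rewrite ler_pdivrMr// mulrC.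
  by move: h4 i0; clear; lra.
have [[s1 y1 Kl Ku] [[mu sh Bl s5 s3] [hz z128 rh sL]]] :=
  parameter_regime eps_gt0 eps_lt c0 c512 n0 k2 m0 r1 kn rk mlt.
move: s1 y1 Kl Ku mu sh Bl s5 s3 hz z128 rh sL.
set L := ln k%:R; set s := Num.sqrt L; set h := expR (L / 2); set y := expR _.
set K := k.-1; set B := (n.-1 %/ K)%N => s1 y1 Kl Ku mu sh Bl s5 s3 hz z128 rh sL.
have K0 : (0 < K)%N by rewrite /K; case: (k) k2 => [|[]].
have h0 : 0 < h by exact: expR_gt0.
have s0 : 0 < s by exact: lt_le_trans s1.
have r0 : 0 < r by exact: lt_le_trans r1.
have BR0 : 0 < B%:R :> R.
  by apply: lt_le_trans Bl; rewrite divr_gt0 ?mulr_gt0// (lt_le_trans ltr01).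
have B0 : (0 < B)%N by rewrite -(ltr_nat R).
(* Dividing [n - 1] rather than [n] keeps the index [K * B] free: the blocks fill the columns below
   it. *)
have KBn : (K * B < n)%N.
  by rewrite mulnC (leq_ltn_trans (leq_trunc_div _ _))// prednK.
have cKB : (#|{: 'I_K * 'I_B}| <= n)%N by rewrite card_prod !card_ord ltnW.
pose e (z : 'I_K * 'I_B) := widen_ord cKB (enum_rank z).
pose j0 : 'I_n := Ordinal KBn.
have inj_e : injective e.
  move=> z z' /(congr1 val) /= zz'; apply: enum_rank_inj; exact: val_inj.
have ej0 z : e z != j0.
  apply/eqP => /(congr1 val) /= zE; have := ltn_ord (enum_rank z).
  by rewrite zE card_prod !card_ord ltnn.
have [b12 F] := separation_parameters K0 eps_gt0 r1 s1 y1 h0 c0 Kl Ku mu sh Bl s5 s3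
  c216 ceps hz z128.
move: b12 F; set t := 4 * s / r => b12 F.
have t0 : 0 <= t by rewrite divr_ge0 ?mulr_ge0// ltW.
have rt : r * t = 4 * s by rewrite /t mulrC divfK// gt_eqF.
pose sep := \bigcup_(sg in [set: {ffun 'I_K -> 'I_B}]) \bigcap_(i in [set: 'I_m])
  [set w | t < `|sum_over a (slots e sg i) w|].
have Psep := separated_sums_prob iid inj_e K0 B0 t0 b12 F.
rewrite -/sep in Psep.
pose out : set R := ~` `[- (4 * s), 4 * s].
pose big := \bigcup_(i in [set: 'I_m]) (a (i, j0) @^-1` out : set T).
pose bad := [set w | ~ universal_support_recovery k r (random_matrix a w)].
have mbad : measurable bad by exact: measurable_not_recovery.
have mcol i : measurable (a (i, j0) @^-1` out : set T).
  rewrite -[_ @^-1` _]setTI; apply: measurable_funP => //; exact: measurableC.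
have mbig : measurable big by apply: fin_bigcup_measurable => // i _.
have msep : measurable sep.
  apply: fin_bigcup_measurable => // sg _; apply: fin_bigcap_measurable => // i _.
  rewrite (_ : [set _ | _] = (fun w => t < `|sum_over a (slots e sg i) w|) @^-1` [set true])//.
  rewrite -[_ @^-1` _]setTI.
  have mf : measurable_fun setT (fun w => t < `|sum_over a (slots e sg i) w|).
    by apply: measurable_fun_ltr => //; apply: measurableT_comp => //; exact: measurable_sum_over.
  exact: mf.
have sub : sep `<=` bad `|` big.
  move=> w [sg _ hsg]; have [wb|wb] := pselect (big w); [by right|left].
  apply: (@not_recovery_of_separated _ _ _ _ K B r t _ e j0 sg) => //.
  - by rewrite K0 /K ltn_predL; exact: leq_trans k2.
  - move=> i; have := hsg i I; rewrite /= /sum_over /slots big_imset/=; last first.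
      by move=> ? ? _ _; exact: slot_inj.
    by under [in X in _ -> X]eq_bigr do rewrite mxE.
  - move=> i; rewrite mxE rt leNgt; apply/negP => ai; apply: wb; exists i => //=.
    by rewrite /out /= in_itv/= -ler_norml; apply/negP; rewrite -ltNge.
(* The threshold [4 s] makes the tail [expR (- 4 L) = h ^ (-8)] up to [sqrt 2]. Since [m <= h^5] and
   [h >= 16], the union bound is at most [2 / h^3]. *)
have Pbig : (P big <= (1 / 6)%:E)%E.
  apply: le_trans (union_bound P mcol) _.
  have s40 : 0 <= 4 * s by rewrite mulr_ge0// ltW.
  have Pcol i : (P (a (i, j0) @^-1` out) <=
      (Num.sqrt 2 * expR (- (4 * s) ^+ 2 / 4))%R%:E)%E.
    have := normal_prob_tail s40; rewrite -(iid.2 (i, j0))//.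
    exact: measurableC.
  apply: le_trans (lee_sum _ (fun i _ => Pcol i)) _.
  rewrite sumEFin sumr_const card_ord lee_fin -[leLHS]mulr_natr.
  have -> : expR (- (4 * s) ^+ 2 / 4) = (h ^+ 8)^-1.
    by rewrite exprMn sL -expRM_natl -expRN; congr expR; field.
  have m5 : m%:R <= h ^+ 5.
    apply: le_trans mu _.
    have -> : c * r * h ^+ 3 * s = c * (r * h ^+ 3 * s) by ring.
    have -> : h ^+ 5 = h * h ^+ 3 * h by ring.
    have s0' : 0 <= s by exact: ltW.
    have h30 : 0 <= h ^+ 3 by rewrite exprn_ge0// ltW.
    have rh3 : 0 <= r * h ^+ 3 by rewrite mulr_ge0// ltW.
    apply: le_trans (ler_wpM2r (mulr_ge0 rh3 s0') c_le1) _; rewrite mul1r.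
    apply: ler_pM => //; last by move: sh s0'; clear; lra.
    by rewrite ler_wpM2r.
  have q2 : Num.sqrt 2 <= 2 :> R.
    by rewrite -[leRHS]ger0_norm// -sqrtr_sqr ler_wsqrtr//; clear; lra.
  have h8 : 0 < h ^+ 8 by rewrite exprn_gt0.
  have h16 : 16 <= h by move: sh s1; clear; lra.
  have h3 : 16 * (16 * 16) <= h ^+ 3.
    by rewrite exprS expr2; apply: ler_pM => //; apply: ler_pM.
  have qm : Num.sqrt 2 * m%:R <= 2 * h ^+ 5 by apply: ler_pM.
  rewrite [leLHS]mulrAC ler_pdivrMr//; apply: le_trans qm _.
  have -> : h ^+ 8 = h ^+ 3 * h ^+ 5 by rewrite -exprD.
  have h50 : 0 <= h ^+ 5 by rewrite exprn_ge0// ltW.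
  by have := ler_wpM2r h50 h3; move: h50; clear; lra.
have : (P sep <= P bad + P big)%E.
  apply: le_trans (le_measure P _ _ sub) _; rewrite ?inE//; first exact: measurableU.
  exact: measureU2.
rewrite -(fineK (fin_num_measure P _ mbad)) => PU.
have := le_trans Psep (le_trans PU (leeD2l _ Pbig)).
by rewrite -EFinD !lee_fin; clear; lra.
Qed.
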